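(* Let $G$ be a finite simple graph on $n$ vertices. Then $$c(G)-1\ \le\ \operatorname{reg}_{x}\mathcal{R}(I_c(G))\ \le\ n-1.$$
   Context: Let $K$ be a field, let $G$ be a finite simple graph with vertex set $V(G)=[n]=\{1,\dots,n\}$ and edge set $E(G)=\{e_1,\dots,e_m\}$, and let $S=K[x_1,\dots,x_n]$. For each $i$, write $e_i=\{p,q\}$ and put $u_i=(x_1\cdots x_n)/(x_px_q)$. The complementary edge ideal of $G$ is $I_c(G)=(u_1,\dots,u_m)\subset S$, and its Rees algebra is $\mathcal{R}(I_c(G))=\bigoplus_{k\ge 0}I_c(G)^kt^k\subset S[t]$. Let $T=S[y_1,\dots,y_m]$ and view $\mathcal{R}(I_c(G))$ as a $T$-module via the $S$-algebra homomorphism $T\to\mathcal{R}(I_c(G))$, $y_i\mapsto u_it$. Give $T$ the bigrading $\deg x_i=(1,0)$, $\deg y_j=(0,1)$; then $\mathcal{R}(I_c(G))$ is a bigraded $T$-module. Its $x$-regularity is $\operatorname{reg}_x\mathcal{R}(I_c(G))=\max\{a-i:\ \operatorname{Tor}_i^T(\mathcal{R}(I_c(G)),K)_{(a,b)}\ne 0\text{ for some } i,b\ge 0\}$. The number $c(G)$ is the number of connected components of $G$ having at least two vertices. *)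

(* Defs.v *)
From HB Require Import structures.
From mathcomp Require Import all_boot all_order all_algebra.
From mathcomp Require Export mpoly.

Set Implicit Arguments.
Unset Strict Implicit.
Unset Printing Implicit Defensive.

Import GRing.Theory Num.Theory.
Local Open Scope ring_scope.

Record sgraph (n : nat) := SGraph {
  adj : rel 'I_n;
  adj_sym : ssrbool.symmetric adj;
  adj_irr : irreflexive adj
}.

Definition edges n (G : sgraph n) : {set {set 'I_n}} :=
  [set e : {set 'I_n} | [exists p, exists q, adj G p q && (e == [set p; q])]].

Definition edge n (G : sgraph n) (j : 'I_#|edges G|) : {set 'I_n} := enum_val j.

Definition components n (G : sgraph n) : {set {set 'I_n}} :=
  equivalence_partition (connect (adj G)) [set: 'I_n].

Definition nontrivial_components n (G : sgraph n) : nat :=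
  #|[set C in components G | (2 <= #|C|)%N]|.


Section Ideals.
Variable S : comNzRingType.

Definition ideal_gen m (u : 'I_m -> S) (p : S) : Prop :=
  exists c : 'I_m -> S, p = \sum_(j < m) c j * u j.

Definition ideal_mul (I J : S -> Prop) (p : S) : Prop :=
  exists s : seq (S * S),
    (forall ab, ab \in s -> I ab.1 /\ J ab.2) /\ p = \sum_(ab <- s) ab.1 * ab.2.

Fixpoint ideal_pow (I : S -> Prop) (k : nat) : S -> Prop :=
  if k is k'.+1 then ideal_mul I (ideal_pow I k') else fun=> True.

(* As a subset of S[t]: the coefficient of t^k lies in I^k. *)
Definition rees (I : S -> Prop) (f : {poly S}) : Prop :=
  forall k : nat, ideal_pow I k f`_k.

End Ideals.

Section BigradedRing.
Variables (K : fieldType) (n m : nat).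

Definition Sring := {mpoly K[n]}.
Definition Tring := {mpoly {mpoly K[n]}[m]}.

(* p is bihomogeneous of bidegree (a, b) for deg x_i = (1, 0) and
   deg y_j = (0, 1); zero is so for every (a, b), including negative ones. *)
Definition T_homog (p : Tring) (a b : int) : Prop :=
  forall (mu : 'X_{1..m}) (nu : 'X_{1..n}),
    nu \in msupp p@_mu -> (mdeg nu)%:Z = a /\ (mdeg mu)%:Z = b.

(* The surjection T -> K = T / (x_1, .., x_n, y_1, .., y_m), through which T
   acts on K. *)
Definition T_residue (p : Tring) : K := (p@_0%MM)@_0%MM.

(* A resolution by T-modules F_i = T^(rk i), in which the j-th basis vector of
   F_i has bidegree [bdeg i j], of K placed in bidegree (0, 0).
   Elements of F_i are row vectors; the maps are v |-> v *m diff i and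
   v |-> (map_mx T_residue v *m aug) 0 0. *)
Record bigraded_free_resolution_of_K := BigradedFreeResolution {
  rk : nat -> nat;
  bdeg : forall i, 'I_(rk i) -> int * int;
  diff : forall i, 'M[Tring]_(rk i.+1, rk i);
  aug : 'cV[K]_(rk 0);
  diff_homog : forall i (j : 'I_(rk i.+1)) (k : 'I_(rk i)),
    T_homog (diff i j k) ((bdeg j).1 - (bdeg k).1) ((bdeg j).2 - (bdeg k).2);
  aug_homog : forall j : 'I_(rk 0), aug j 0 != 0 -> bdeg j = (0, 0);
  aug_surj : forall c : K,
    exists v : 'rV[Tring]_(rk 0), (map_mx T_residue v *m aug) 0 0 = c;
  exact_0 : forall v : 'rV[Tring]_(rk 0),
    (map_mx T_residue v *m aug) 0 0 = 0 <-> exists w, v = w *m diff 0;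
  exact_S : forall i (v : 'rV[Tring]_(rk i.+1)),
    v *m diff i = 0 <-> exists w, v = w *m diff i.+1
}.

(* A bigraded T-module is given here as a subset M of a ring A, where T acts
   through a ring morphism phi : T -> A, and [hom p a b] says that p is
   homogeneous of bidegree (a, b).  Then M (x)_T F_i = M^(rk i), and its
   differential is multiplication by the image of [diff] under phi. *)
Section Tor.
Variables (A : comNzRingType) (phi : Tring -> A) (M : A -> Prop).
Variable hom : A -> int -> int -> Prop.

Definition tensor_cycle (F : bigraded_free_resolution_of_K) (i : nat) :
    'rV[A]_(rk F i) -> Prop :=
  match i with
  | 0 => fun=> True
  | i'.+1 => fun z => z *m map_mx phi (diff F i') = 0
  end.

Definition tensor_boundary (F : bigraded_free_resolution_of_K) (i : nat)
    (z : 'rV[A]_(rk F i)) : Prop :=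
  exists w : 'rV[A]_(rk F i.+1),
    (forall j, M (w 0 j)) /\ z = w *m map_mx phi (diff F i).

(* Tor_i^T(M, K)_(a, b) <> 0, where Tor_i^T(M, -) is the i-th left derived
   functor of M (x)_T -.  It does not depend on the resolution F of K. *)
Definition Tor_neq0 (i : nat) (a b : int) : Prop :=
  exists (F : bigraded_free_resolution_of_K) (z : 'rV[A]_(rk F i)),
    [/\ forall j, M (z 0 j),
        forall j, hom (z 0 j) (a - (bdeg j).1) (b - (bdeg j).2),
        tensor_cycle z
      & ~ tensor_boundary z].

Definition is_x_regularity (r : int) : Prop :=
  (exists (i b : nat) (a : int), Tor_neq0 i a b%:Z /\ r = a - i%:Z)
  /\ (forall (i b : nat) (a : int), Tor_neq0 i a b%:Z -> a - i%:Z <= r).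

End Tor.
End BigradedRing.

Section ComplementaryEdgeIdeal.
Variables (K : fieldType) (n : nat) (G : sgraph n).
Local Notation m := #|edges G|.

(* (x_1 .. x_n) / (x_p x_q) for the j-th edge {p, q}. *)
Definition comp_gen (j : 'I_m) : {mpoly K[n]} :=
  \prod_(i < n | i \notin edge j) 'X_i.

Definition comp_edge_ideal : {mpoly K[n]} -> Prop := ideal_gen comp_gen.

(* The S-algebra morphism T -> S[t], y_j |-> u_j t. *)
Definition rees_map : Tring K n m -> {poly {mpoly K[n]}} :=
  mmap (@polyC {mpoly K[n]}) (fun j => (comp_gen j)%:P * 'X).

(* Bidegrees on S[t] making [rees_map] bigraded: since every u_j has degree
   n - 2, they are deg x_i = (1, 0) and deg t = (2 - n, 1). *)
Definition rees_homog (f : {poly {mpoly K[n]}}) (a b : int) : Prop :=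
  forall (k : nat) (nu : 'X_{1..n}), nu \in msupp f`_k ->
    (mdeg nu)%:Z + k%:Z * (2 - n%:Z) = a /\ k%:Z = b.

Definition is_reg_x_rees (r : int) : Prop :=
  is_x_regularity rees_map (rees comp_edge_ideal) rees_homog r.

End ComplementaryEdgeIdeal.

(* Main.v *)
Require Import Defs.
From mathcomp Require Import all_boot all_order all_algebra zify ring.
From Stdlib Require Import Classical.

Set Implicit Arguments.
Unset Strict Implicit.
Unset Printing Implicit Defensive.

Import Order.TTheory GRing.Theory Num.Theory.
Local Open Scope ring_scope.

(** Write R for the Rees algebra, S for K[x_1, .., x_n] and T for
    S[y_1, .., y_m].  The exponent of x_v in a product of k of the generators
    of I_c(G) is k minus the degree of v in the multiset of the k edges used.
    So x^al t^k lies in R if and only if some k edges, with repetitions, have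
    degrees d_v with k <= al_v + d_v at every vertex v ([reesP]), and both
    bounds become statements about degree sequences of edge multisets.

    Upper bound.  Let F be any bigraded free resolution of K.  Filter R by
    T-submodules spanned by monomials: first by the power of t, so that the y_j
    act by zero on the quotients I_c(G)^k t^k, then inside I_c(G)^k by a list of
    monomials g.  If the colon ideal of each g by its predecessors is generated
    by variables, each quotient of the filtration is T modulo some x_i and all
    the y_j, shifted by the x-degree of g t^k.  These variables have x-degree at
    most 1, so adding them one at a time to the ideal keeps Tor_i in x-degrees
    at most i ([koszul_vanishing]), and reg_x R is at most the largest shift.

    The generators of I_c(G)^k alone need not admit such an order: for two
    disjoint triangles and k = 3 every order has a colon ideal whose minimal
    generators include the square of a variable.  The remedy is to also list
    multiples of the generators.  Call a vertex a root if it has neighbours and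
    all of them are larger.  The list consists of the monomials
    x^(k - deg E) x_U, for E a multiset of k edges and U a set of roots, with
    the lexicographically larger deg E first, and the larger U first when the
    degrees agree.  The shift of such a monomial is the size of U
    ([mdeg_genm]); the last vertex is not a root, whence n - 1 ([card_roots]).
    That the colon ideals are generated by variables ([colon_by_variables])
    comes from exchanging edges along alternating trails ([alternating_trail],
    [lex_exchange]).

    Lower bound.  Let s + 1 be the number of components with an edge, choose an
    edge e_j in each, and put f_j = x_p x_q for e_j = {p, q}, so that
    f_j (u_j t) = x_1 .. x_n t for all j.  In the Koszul complex the boundary of
    the product of the basis vectors of y_(e_0), .., y_(e_s), multiplied by
    f_0 .. f_s, is divisible by x_1 .. x_n t, and the quotient Zeta is a
    cycle of homological degree s and bidegree (2 s, s).  To see that it is not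
    a boundary, give every variable the label of its component and evaluate a
    chain on the basis vectors with one variable of each label 1, .., s,
    multiplying each coefficient by those variables.  On Zeta this gives
    (x_1 .. x_n t)^s up to sign ([Psi_Zeta]).  On a boundary it gives a
    combination of products of one variable from each of the s + 1 components
    ([Psi_d]), and in such a combination the monomial (x_1 .. x_n t)^s cannot
    occur, as s edges do not meet s + 1 components ([not_hits]). *)

(** * Degree sequences of edge multisets *)

Definition vdeg n (G : sgraph n) (E : seq 'I_#|edges G|) (v : 'I_n) : nat :=
  count (fun j => v \in edge j) E.

(* Indicators such as (v == u) only enter linearly, so they can be replaced by
   unknown numbers. *)
Ltac nlia :=
  clear; rewrite ?eqxx /=;
  repeat match goal with
  | |- context[nat_of_bool ?b] => move: (nat_of_bool b) => ?
  end; lia.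

Section DegreeSequences.
Variables (n : nat) (G : sgraph n).
Local Notation m := #|edges G|.
Implicit Types (E F : seq 'I_m) (u v : 'I_n) (j : 'I_m).

Lemma vdeg_cons j E v : vdeg (j :: E) v = ((v \in edge j) + vdeg E v)%N.
Proof. by []. Qed.

Lemma edgeP (j : 'I_m) :
  exists p q, [/\ adj G p q, p != q & edge j = [set p; q]].
Proof.
have := enum_valP j; rewrite inE => /existsP[p /existsP[q /andP[pq /eqP eqj]]].
exists p, q; split=> //; apply: contraTneq pq => ->.
by rewrite (adj_irr G).
Qed.

Lemma edge_other_end (j : 'I_m) (b : 'I_n) : b \in edge j ->
  exists c, [/\ adj G b c, c != b & forall v, (v \in edge j : nat) = ((v == b) + (v == c))%N].
Proof.
have [p [q [pq pNq ->]]] := edgeP j.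
have inE2 v : (v \in [set p; q] : nat) = ((v == p) + (v == q))%N.
  rewrite !inE; case: (eqVneq v p) => [->|_] //=; by rewrite (negPf pNq).
rewrite !inE => /orP[] /eqP->.
  by exists q; split; rewrite // eq_sym.
exists p; split; rewrite // 1?(adj_sym G) // => v.
by rewrite inE2 addnC.
Qed.

Lemma adj_edge p q : adj G p q -> exists j : 'I_m,
  forall v, (v \in edge j : nat) = ((v == p) + (v == q))%N.
Proof.
move=> pq; have pNq : p != q by apply: contraTneq pq => ->; rewrite (adj_irr G).
have inEG : [set p; q] \in edges G.
  by rewrite inE; apply/existsP; exists p; apply/existsP; exists q; rewrite pq eqxx.
exists (enum_rank_in inEG [set p; q]) => v.
rewrite /edge enum_rankK_in // !inE.
by case: (eqVneq v p) => [->|_] //=; rewrite (negPf pNq).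
Qed.

Lemma vdeg_perm E F : perm_eq E F -> vdeg E =1 vdeg F.
Proof. by move=> /permP EF v; apply: EF. Qed.

Lemma vdeg_excess_edge E F u : (vdeg F u < vdeg E u)%N ->
  exists j E', [/\ u \in edge j, vdeg E =1 vdeg (j :: E') & size E = (size E').+1].
Proof.
move=> lt_u; have /hasP[j jE ju] : has (fun j => u \in edge j) E.
  by rewrite has_count; apply: leq_trans lt_u.
have EE' := perm_to_rem jE.
exists j, (rem j E); split=> //; first exact: vdeg_perm.
by rewrite (perm_size EE').
Qed.

(** Walk from u, alternately removing an edge of E and adding an edge of F at
    the vertex just reached.  The walk stops when a removal ends at a vertex x
    where the degree in E exceeds that in F, or an addition ends at a vertex x
    where it is smaller.  Each round consumes an edge of E, so it does stop.
    In the second case the same swap, performed backwards on F, brings the two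
    degree sequences closer; it is therefore recorded too. *)
Lemma alternating_trail E F u : (vdeg F u < vdeg E u)%N ->
  (exists E' x, [/\ size E = (size E').+1,
      forall v, vdeg E v = (vdeg E' v + (v == u) + (v == x))%N
    & (vdeg F x + (x == u) < vdeg E x)%N])
  \/ (exists E' F' x, [/\ size E' = size E /\ size F' = size F,
      forall v, (vdeg E' v + (v == u) = vdeg E v + (v == x))%N,
      forall v, (vdeg F' v + (v == x) = vdeg F v + (v == u))%N
    & (vdeg E x < vdeg F x + (x == u))%N]).
Proof.
have [k] := ubnP (size E); elim: k => // k IHk in E F u *; rewrite ltnS => leEk.
move=> lt_u; have [j [E1 [uj EE1 szE]]] := vdeg_excess_edge lt_u.
have [b [ub bNu edgej]] := edge_other_end uj.
have dE v : vdeg E v = ((v == u) + (v == b) + vdeg E1 v)%N by rewrite EE1 vdeg_cons edgej.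
(* The walk has just removed the edge j from u to b. *)
case: (ltnP (vdeg F b) (vdeg E b)) => [lt_b | ge_b].
  left; exists E1, b; split=> // [v|]; first by rewrite dE; nlia.
  by rewrite (negPf bNu) addn0.
have lt_b1 : (vdeg E1 b < vdeg F b)%N.
  by apply: leq_trans ge_b; rewrite dE eqxx; nlia.
have [i [F1 [bi FF1 szF]]] := vdeg_excess_edge lt_b1.
have [c [bc cNb edgei]] := edge_other_end bi.
have dF v : vdeg F v = ((v == b) + (v == c) + vdeg F1 v)%N by rewrite FF1 vdeg_cons edgei.
(* It has now added the edge i from b to c.  If it does not stop at c, it goes
   on from there with E1 and F1. *)
case: (ltnP (vdeg E c) (vdeg F c + (c == u))%N) => [lt_c | ge_c].
  right; exists (i :: E1), (j :: F1), c; split=> // [v|v].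
  - by rewrite vdeg_cons edgei dE; nlia.
  - by rewrite vdeg_cons edgej dF; nlia.
have lt_c1 : (vdeg F1 c < vdeg E1 c)%N.
  by move: ge_c; rewrite dE dF eqxx (negPf cNb); nlia.
have ltE1k : (size E1 < k)%N by rewrite szE in leEk.
case: (IHk _ _ _ ltE1k lt_c1) => [[E' [x [szE' dE' lt_x]]]|[E' [F' [x [[szE' szF'] dE' dF' lt_x]]]]].
  left; exists (i :: E'), x; split=> [|v|].
  - by rewrite szE szE'.
  - by rewrite vdeg_cons edgei dE dE'; nlia.
  - by move: lt_x; rewrite dE dF; nlia.
right; exists (i :: E'), (j :: F'), x; split=> [|v|v|].
- by rewrite /= szE szF szE' szF'.
- by move: (dE' v); rewrite vdeg_cons edgei dE; nlia.
- by move: (dF' v); rewrite vdeg_cons edgej dF; nlia.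
- by move: lt_x; rewrite dE dF; nlia.
Qed.

End DegreeSequences.

(** * Lexicographic exchange *)

Section LexExchange.
Variables (n : nat) (G : sgraph n).
Local Notation m := #|edges G|.

Implicit Types (E F : seq 'I_m) (u v : 'I_n).

Definition degm (E : seq 'I_m) : 'X_{1..n} := [multinom vdeg E v | v < n].

Lemma degmE E v : degm E v = vdeg E v.
Proof. exact: mnmE. Qed.

Lemma card_edge (j : 'I_m) : #|edge j| = 2%N.
Proof. by have [p [q [_ pNq ->]]] := edgeP j; rewrite cards2 pNq. Qed.

Lemma sum_vdeg E : (\sum_v vdeg E v = 2 * size E)%N.
Proof.
elim: E => [|j E IH]; first by rewrite big1.
under eq_bigr do rewrite vdeg_cons.
rewrite big_split /= IH mulnS; congr addn.
by rewrite -(card_edge j) -sum1_card [RHS]big_mkcond /=; apply: eq_bigr => v _; case: ifP.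
Qed.

Lemma mdeg_degm E : mdeg (degm E) = (2 * size E)%N.
Proof. by rewrite mdegE -sum_vdeg; apply: eq_bigr => v _; rewrite degmE. Qed.

(** A vertex on an edge that is not a root has a smaller neighbour; joining the
    two is the way to restore a unit of degree at that vertex with a
    lexicographic gain. *)
Definition is_root (u : 'I_n) : bool :=
  [exists v, adj G u v] && [forall v, adj G u v ==> (u < v)%N].

Lemma vdeg_gt0_adj E v : (0 < vdeg E v)%N -> exists q, adj G v q.
Proof.
rewrite -has_count => /hasP[j _ /edge_other_end[c [vc _ _]]].
by exists c.
Qed.

Lemma nonroot_smaller_neighbour E u : (0 < vdeg E u)%N -> ~~ is_root u ->
  exists2 s, adj G u s & (s < u)%N.
Proof.
move=> /vdeg_gt0_adj[q uq]; rewrite negb_and => /orP[/existsP[]|]; first by exists q.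
rewrite negb_forall => /existsP[s]; rewrite negb_imply -leqNgt leq_eqVlt => /andP[us].
case/orP=> [/eqP/val_inj su|]; last by exists s.
by move: us; rewrite su (adj_irr G).
Qed.

Lemma lt_degm E F (v : 'I_n) : size E = size F ->
  (forall j : 'I_n, (j < v)%N -> vdeg E j = vdeg F j) -> (vdeg E v < vdeg F v)%N ->
  (degm E < degm F)%O.
Proof.
move=> szEF eqEF ltEF; apply/ltmcP; first by rewrite !mdeg_degm szEF.
by exists v => [j ltjv|]; rewrite !degmE //; apply: eqEF.
Qed.

Lemma lt_degmP E F : size E = size F -> (degm E < degm F)%O ->
  exists v : 'I_n, (forall j : 'I_n, (j < v)%N -> vdeg E j = vdeg F j)
                   /\ (vdeg E v < vdeg F v)%N.
Proof.
move=> szEF; have eqd : mdeg (degm E) = mdeg (degm F) by rewrite !mdeg_degm szEF.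
case/(ltmcP eqd) => v eqEF; rewrite !degmE => ltv; exists v; split=> // j /eqEF.
by rewrite !degmE.
Qed.

(** Divisibility of generators: for multisets of k edges, x^(k - deg E')
    divides x_u x^(k - deg E), respectively x_u x_x x^(k - deg E). *)
Definition short_by1 E E' u := forall v, (vdeg E v <= vdeg E' v + (v == u))%N.
Definition short_by2 E E' u x := forall v, (vdeg E v <= vdeg E' v + (v == u) + (v == x))%N.

(** E' is E with one unit of degree less at p and at q, so there is room for one
    more edge.  If p has a smaller neighbour, joining p to it repairs p and
    leaves only q short.  Otherwise any edge at v, the first vertex where
    E and F differ, makes the result lexicographically larger than E. *)
Lemma pair_exchange E F E' p q (v : 'I_n) : size E = (size E').+1 -> size E = size F ->
  (forall j : 'I_n, (j < v)%N -> vdeg E j = vdeg F j) -> (vdeg E v < vdeg F v)%N ->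
  (forall w, vdeg E w = (vdeg E' w + (w == p) + (w == q))%N) ->
  (p <= q)%N -> (vdeg F p < vdeg E p)%N ->
  exists E2, [/\ size E2 = size E, (degm E < degm E2)%O &
     (short_by1 E E2 q) \/ (is_root p /\ short_by2 E E2 p q)].
Proof.
move=> szE szEF eqEF ltv dE pq ltp.
have ltvp : (v < p)%N.
  rewrite ltnNge; apply/negP; rewrite leq_eqVlt => /orP[/eqP/val_inj epv|/eqEF epv].
    by move: ltp ltv; rewrite epv; lia.
  by move: ltp; rewrite epv ltnn.
case rt: (is_root p).
  have [r vr] : exists r, adj G v r by apply: (@vdeg_gt0_adj F); lia.
  have [j dj] := adj_edge vr.
  have dE2 w : vdeg (j :: E') w = ((w == v) + (w == r) + vdeg E' w)%N by rewrite vdeg_cons dj.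
  exists (j :: E'); split=> //; last by right; split=> // w; rewrite dE dE2; nlia.
  pose h := if (v <= r)%N then v else r.
  have hv : (h <= v)%N by rewrite /h; case: (leqP v r) => ?; lia.
  have hr : (h <= r)%N by rewrite /h; case: (leqP v r) => ?; lia.
  have hN (w z : 'I_n) : (w < z)%N -> (w == z) = false by move=> wz; rewrite -val_eqE ltn_eqF.
  apply: (@lt_degm _ _ h) => // [w wh|].
    by rewrite dE dE2 !(hN w) //; lia.
  rewrite dE dE2 (hN h p) ?(hN h q); try lia.
  by rewrite /h; case: (leqP v r) => _; nlia.
have [s ps sp] : exists2 s, adj G p s & (s < p)%N.
  by apply: (@nonroot_smaller_neighbour E); rewrite ?rt //; lia.
have [j dj] := adj_edge ps.
have dE2 w : vdeg (j :: E') w = ((w == p) + (w == s) + vdeg E' w)%N by rewrite vdeg_cons dj.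
exists (j :: E'); split=> //; last by left=> w; rewrite dE dE2; nlia.
have hN (w z : 'I_n) : (w < z)%N -> (w == z) = false by move=> wz; rewrite -val_eqE ltn_eqF.
apply: (@lt_degm _ _ s) => // [w wh|].
  by rewrite dE dE2 !(hN w) //; lia.
by rewrite dE dE2 (hN s p) ?(hN s q) ?eqxx /=; lia.
Qed.

(** Start a trail at a vertex u where E exceeds F.  If it removes an edge from
    E, [pair_exchange] applies to its two ends.  If it moves a unit of degree
    from u to x with x < u, the result is lexicographically larger.  If x > u,
    replace F by its swapped version: the first difference with E is
    unchanged, the excess of E over F has only decreased, and induction
    applies. *)
Lemma lex_exchange E F : size E = size F -> (degm E < degm F)%O ->
  exists E2, [/\ size E2 = size E, (degm E < degm E2)%O &
     (exists u, (vdeg F u < vdeg E u)%N /\ short_by1 E E2 u) \/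
     (exists u x, [/\ is_root u, (vdeg F u < vdeg E u)%N,
                      (vdeg F x + (x == u) < vdeg E x)%N & short_by2 E E2 u x])].
Proof.
have [k] := ubnP (\sum_v (vdeg E v - vdeg F v))%N.
elim: k => // k IHk in F *; rewrite ltnS => leEk szEF ltEF.
have [v [eqEF ltv]] := lt_degmP szEF ltEF.
have [u ltu] : exists u, (vdeg F u < vdeg E u)%N.
  apply/existsP; apply: contraTT (ltv); rewrite negb_exists => /forallP leEF.
  have : (\sum_w vdeg E w == \sum_w vdeg F w)%N.
    by rewrite !sum_vdeg szEF.
  have le w : (vdeg E w <= vdeg F w)%N by have := leEF w; rewrite -leqNgt.
  have := leqif_sum (fun w (_ : true) => leqif_eq (le w)) => /= H.
  by rewrite H => /forallP /(_ v) /=; rewrite -leqNgt => /eqP ->.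
have ltvu : (v < u)%N.
  rewrite ltnNge; apply/negP; rewrite leq_eqVlt => /orP[/eqP/val_inj epv|/eqEF epv].
    by move: ltu ltv; rewrite epv; lia.
  by move: ltu; rewrite epv ltnn.
have hN (w z : 'I_n) : (w < z)%N -> (w == z) = false by move=> wz; rewrite -val_eqE ltn_eqF.
case: (alternating_trail ltu) => [[E' [x [szE' dE lt_x]]]|[E' [F' [x [[szE' szF'] dE' dF' lt_x]]]]].
- have ltx : (vdeg F x < vdeg E x)%N by apply: leq_ltn_trans lt_x; rewrite leq_addr.
  have [le_ux | lt_xu] := leqP u x.
    have [E2 [sz2 lt2 H]] := pair_exchange szE' szEF eqEF ltv dE le_ux ltu.
    by exists E2; split=> //; case: H => [d1|[rt d2]]; [left; exists x | right; exists u, x].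
  have dE' w : vdeg E w = (vdeg E' w + (w == x) + (w == u))%N by rewrite dE addnAC.
  have [E2 [sz2 lt2 H]] := pair_exchange szE' szEF eqEF ltv dE' (ltnW lt_xu) ltx.
  exists E2; split=> //; case: H => [d1|[rt d2]]; [left; exists u => // | right; exists x, u].
  by split=> //; rewrite eq_sym hN // addn0.
have xNu : (x == u) = false by apply: contraTF lt_x => /eqP->; rewrite eqxx -leqNgt addn1.
move: lt_x; rewrite xNu addn0 => lt_x.
have [lt_xu | le_ux] := ltnP x u.
  exists E'; split=> //; last first.
    by left; exists u; split=> // w; move: (dE' w); nlia.
  apply: (@lt_degm _ _ x) => // [w wx|].
    by have := dE' w; rewrite (hN w x) // (hN w u) //; lia.
  by have := dE' x; rewrite eqxx (hN x u) //=; lia.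
have ltux : (u < x)%N by rewrite ltn_neqAle le_ux andbT eq_sym; apply/negP => /eqP/val_inj/eqP; rewrite xNu.
have szEF' : size E = size F' by rewrite szF'.
have ltEF' : (degm E < degm F')%O.
  apply: (@lt_degm _ _ v) => // [w wv|].
    by have := dF' w; rewrite eqEF // (hN w x) ?(hN w u) //; lia.
  by have := dF' v; rewrite (hN v x) ?(hN v u) //; lia.
have leF' w : (vdeg E w - vdeg F' w <= vdeg E w - vdeg F w)%N.
  have := dF' w; case: (eqVneq w x) => [->|wx]; first by move: lt_x; rewrite xNu /=; lia.
  by case: (w == u) => /=; lia.
case: (IHk F' _ szEF' ltEF') => [|E2 [sz2 lt2 H]].
  apply: leq_trans leEk; rewrite (bigD1 u) //= [leqRHS](bigD1 u) //= -addSn leq_add //.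
    by have := dF' u; rewrite eqxx eq_sym xNu /=; lia.
  by apply: leq_sum => w _; apply: leF'.
have up w : (vdeg F' w < vdeg E w -> vdeg F w < vdeg E w)%N by have := leF' w; lia.
exists E2; split=> //; case: H => [[y [lty d1]]|[y [z [rt lty ltz d2]]]].
  by left; exists y; split=> //; apply: up.
right; exists y, z; split=> //; first exact: up.
by have := leF' z; lia.
Qed.

End LexExchange.

(** * Rings with a basis of monomials *)

(** The common interface of T and of S[t].  Both are nested polynomial rings;
    bihomogeneous elements, ideals of variables and the modules filtering the
    Rees algebra are all described by a condition on the monomials that
    occur. *)
Record monomial_algebra (K : fieldType) (A : comNzRingType) (Mo : Type) := MonomialAlgebra {
  cf : A -> Mo -> K;
  mop : Mo -> Mo -> Mo;
  cfB : forall f g u, cf (f - g) u = cf f u - cf g u;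
  cf_inj : forall f g, cf f =1 cf g -> f = g;
  cfM : forall f g u, cf (f * g) u != 0 ->
    exists u1 u2, [/\ cf f u1 != 0, cf g u2 != 0 & u = mop u1 u2];
  cf_filter : forall (Q : Mo -> bool) f, exists g, forall u, cf g u = if Q u then cf f u else 0
}.

Section Supported.
Variables (K : fieldType) (A : comNzRingType) (Mo : Type) (X : monomial_algebra K A Mo).

Definition supported (P : Mo -> Prop) (f : A) : Prop := forall u, cf X f u != 0 -> P u.

Lemma cf0 u : cf X 0 u = 0.
Proof. by rewrite -[in LHS](subrr (0 : A)) cfB subrr. Qed.

Lemma cfN f u : cf X (- f) u = - cf X f u.
Proof. by rewrite -[in LHS](sub0r f) cfB cf0 sub0r. Qed.

Lemma cfD f g u : cf X (f + g) u = cf X f u + cf X g u.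
Proof. by rewrite -[in LHS](opprK g) cfB cfN opprK. Qed.

Lemma supported0 P : supported P 0.
Proof. by move=> u; rewrite cf0 eqxx. Qed.

Lemma supportedN P f : supported P f -> supported P (- f).
Proof. by move=> Pf u; rewrite cfN oppr_eq0; apply: Pf. Qed.

Lemma supportedD P f g : supported P f -> supported P g -> supported P (f + g).
Proof.
move=> Pf Pg u; rewrite cfD; case: (eqVneq (cf X f u) 0) => [->|/Pf//].
by rewrite add0r; apply: Pg.
Qed.

Lemma supportedB P f g : supported P f -> supported P g -> supported P (f - g).
Proof. by move=> Pf Pg; apply: supportedD => //; apply: supportedN. Qed.

Lemma supported_sum P (I : Type) (r : seq I) (Q : pred I) (f : I -> A) :
  (forall i, Q i -> supported P (f i)) -> supported P (\sum_(i <- r | Q i) f i).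
Proof. by move=> Pf; apply: big_ind => //; [apply: supported0 | apply: supportedD]. Qed.

Lemma supportedM P Q R f g : supported P f -> supported Q g ->
  (forall u v, P u -> Q v -> R (mop X u v)) -> supported R (f * g).
Proof. by move=> Pf Qg PQR u nz; have [u1 [u2 [/Pf Pu /Qg Qu ->]]] := cfM nz; apply: PQR. Qed.

Lemma supportedW (P Q : Mo -> Prop) f : (forall u, P u -> Q u) -> supported P f -> supported Q f.
Proof. by move=> PQ Pf u /Pf/PQ. Qed.

Lemma supported_filter P (Q : Mo -> bool) f : supported P f -> exists g,
  [/\ supported (fun u => P u /\ Q u) g & supported (fun u => P u /\ ~~ Q u) (f - g)].
Proof.
move=> Pf; have [g gE] := cf_filter X Q f; exists g; split=> u.
  by rewrite gE; case: (Q u) => [/Pf//|]; rewrite eqxx.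
by rewrite cfB gE; case: (Q u); rewrite ?subrr ?eqxx // subr0 => /Pf.
Qed.

Lemma supported_disjoint (P Q : Mo -> Prop) f : (forall u, P u -> ~ Q u) ->
  supported P f -> supported Q f -> f = 0.
Proof.
move=> PQ Pf Qf; apply: (@cf_inj _ _ _ X) => u; rewrite cf0; apply/eqP/negPn/negP => nz.
exact: (PQ u (Pf u nz) (Qf u nz)).
Qed.

End Supported.

Section Instances.
Variables (K : fieldType).

Lemma mcoeff_filter (R : nzRingType) n (Q : 'X_{1..n} -> bool) (p : {mpoly R[n]}) k (F : 'X_{1..n} -> R) :
  (forall u, p@_u = 0 -> F u = 0) ->
  (\sum_(u <- msupp p | Q u) F u *: 'X_[u])@_k = if Q k then F k else 0.
Proof.
move=> F0; rewrite (raddf_sum (mcoeff k)) /=.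
under eq_bigr do rewrite mcoeffZ mcoeffX.
have [kp|kp] := boolP (k \in msupp p).
  rewrite big_mkcond (bigD1_seq k) ?msupp_uniq //= eqxx mulr1 big1 ?addr0 // => u /negPf ukN.
  by rewrite ukN mulr0; case: ifP.
rewrite F0 ?memN_msupp_eq0 // if_same big1_seq // => u /andP[_ up].
by case: eqP up kp => [-> ->|] //; rewrite mulr0.
Qed.

Lemma mcoeffM_neq0 n (p q : {mpoly K[n]}) u : (p * q)@_u != 0 ->
  exists u1 u2, [/\ p@_u1 != 0, q@_u2 != 0 & u = (u1 + u2)%MM].
Proof.
rewrite -mcoeff_msupp => /msuppM_le /allpairsP[[u1 u2] /= [p1 q2 ->]].
by exists u1, u2; rewrite -!mcoeff_msupp.
Qed.

Lemma sum_neq0 (V : nmodType) (I : Type) (r : seq I) (P : pred I) (F : I -> V) :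
  \sum_(i <- r | P i) F i != 0 -> exists2 i, P i & F i != 0.
Proof.
move=> nz; elim: r nz => [|i r IH]; first by rewrite big_nil eqxx.
rewrite big_cons; case: ifP => // Pi.
by case: (eqVneq (F i) 0) => [->|? _]; [rewrite add0r | exists i].
Qed.

Definition bipolynomials n m : monomial_algebra K (Tring K n m) ('X_{1..m} * 'X_{1..n}).
Proof.
exists (fun p u => (p@_u.1)@_u.2) (fun u v => ((u.1 + v.1)%MM, (u.2 + v.2)%MM)).
- by move=> f g u; rewrite !mcoeffB.
- move=> f g fg; apply/mpolyP => mu; apply/mpolyP => nu; exact: (fg (mu, nu)).
- move=> f g [mu nu] /=; rewrite mcoeffM (raddf_sum (mcoeff nu)) /=.
  case/sum_neq0 => -[mu1 mu2] /= /eqP emu /mcoeffM_neq0[nu1 [nu2 [f1 g2 ->]]].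
  by exists (bmnm mu1, nu1), (bmnm mu2, nu2); split=> //; rewrite -emu.
- move=> Q f; pose F mu := \sum_(nu <- msupp f@_mu | Q (mu, nu)) f@_mu@_nu *: 'X_[nu].
  exists (\sum_(mu <- msupp f | true) F mu *: 'X_[mu]) => -[mu nu] /=.
  rewrite (mcoeff_filter xpredT) => [|u u0]; last by rewrite /F u0 msupp0 big_nil.
  by rewrite (@mcoeff_filter _ _ (fun nu => Q (mu, nu)) _ _ (fun nu => f@_mu@_nu)).
Defined.

Definition tpolynomials n : monomial_algebra K {poly {mpoly K[n]}} (nat * 'X_{1..n}).
Proof.
exists (fun (f : {poly {mpoly K[n]}}) (u : nat * 'X_{1..n}) => (f`_u.1)@_u.2) (fun u v => ((u.1 + v.1)%N, (u.2 + v.2)%MM)).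
- by move=> f g u; rewrite coefB mcoeffB.
- move=> f g fg; apply/polyP => k; apply/mpolyP => nu; exact: (fg (k, nu)).
- move=> f g [k nu] /=; rewrite coefM (raddf_sum (mcoeff nu)) /=.
  case/sum_neq0 => i _ /mcoeffM_neq0[nu1 [nu2 [f1 g2 ->]]].
  exists (i : nat, nu1), ((k - i)%N, nu2); split=> //=.
  by congr pair; have := ltn_ord i; lia.
- move=> Q f; pose F k := \sum_(nu <- msupp f`_k | Q (k, nu)) (f`_k)@_nu *: 'X_[nu].
  exists (\poly_(k < size f) F k) => -[k nu] /=.
  rewrite coef_poly; case: ltnP => [_|lek].
    by rewrite (@mcoeff_filter _ _ (fun nu => Q (k, nu)) _ _ (fun nu => (f`_k)@_nu)).
  by rewrite (nth_default 0 lek) mcoeff0 if_same.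
Defined.

End Instances.

(** * Ideals generated by variables *)

Lemma mcoeffXM (R : nzRingType) n (p : {mpoly R[n]}) u k : ('X_[u] * p)@_(k + u)%MM = p@_k.
Proof. by rewrite -(commr_mpolyX u p) addmC mcoeffMX. Qed.

Section VariableIdeals.
Variables (K : fieldType) (n m : nat).
Local Notation T := (Tring K n m).
Local Notation TX := (bipolynomials K n m).
Local Notation mono := ('X_{1..m} * 'X_{1..n})%type.
Local Notation var := ('I_n + 'I_m)%type.

Definition tvar (l : var) : T :=
  match l with inl i => ('X_i)%:MP | inr j => 'X_j end.

Definition vdvd (l : var) (u : mono) : bool :=
  match l with inl i => u.2 i != 0%N | inr j => u.1 j != 0%N end.

Definition vmul (l : var) (u : mono) : mono :=
  match l with inl i => (u.1, u.2 + U_(i))%MM | inr j => (u.1 + U_(j), u.2)%MM end.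

Definition xdeg (l : var) : int := if l is inl _ then 1 else 0.
Definition ydeg (l : var) : int := if l is inl _ then 0 else 1.

Definition has_bideg (a b : int) (u : mono) : Prop := (mdeg u.2)%:Z = a /\ (mdeg u.1)%:Z = b.

Lemma T_homogP (p : T) a b : T_homog p a b <-> supported TX (has_bideg a b) p.
Proof.
split=> [hp [mu nu]|hp mu nu]; first by rewrite /= -mcoeff_msupp => /hp.
by rewrite mcoeff_msupp => nz; have := hp (mu, nu) nz.
Qed.

Lemma tvarE l (q : T) u : cf TX (tvar l * q) (vmul l u) = cf TX q u.
Proof.
case: l u => [i|j] [mu nu] /=; last by rewrite mcoeffXM.
by rewrite mul_mpolyC mcoeffZ mcoeffXM.
Qed.

Lemma T_homog_tvar l : T_homog (tvar l) (xdeg l) (ydeg l).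
Proof.
apply/T_homogP => -[mu nu]; case: l => [i|j] /=.
  rewrite mcoeffC; case: (mu =P 0%MM) => [->|_]; last by rewrite mulr0 mcoeff0 eqxx.
  rewrite mulr1 mcoeffX; case: (U_(i)%MM =P nu) => [<- _|_]; last by rewrite eqxx.
  by rewrite /has_bideg /= mdeg1 mdeg0.
rewrite mcoeffX; case: (U_(j)%MM =P mu) => [<-|_]; last by rewrite mcoeff0 eqxx.
rewrite mcoeff1; case: (nu =P 0%MM) => [->|_]; last by rewrite eqxx.
by rewrite /has_bideg /= mdeg1 mdeg0.
Qed.

Lemma tvar_supp l : supported TX (vdvd l) (tvar l).
Proof.
move=> [mu nu]; case: l => [i|j] /=.
  rewrite mcoeffC; case: (mu =P 0%MM) => [_|_]; last by rewrite mulr0 mcoeff0 eqxx.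
  rewrite mulr1 mcoeffX; case: (U_(i)%MM =P nu) => [<- _|_]; last by rewrite eqxx.
  by rewrite mnm1E eqxx.
rewrite mcoeffX; case: (U_(j)%MM =P mu) => [<-|_]; last by rewrite mcoeff0 eqxx.
by rewrite mnm1E eqxx.
Qed.

Lemma vdvdD l u v : vdvd l u || vdvd l v -> vdvd l (mop TX u v).
Proof. by case: l => i /=; rewrite mnmDE addn_eq0 negb_and. Qed.

Lemma tvar_div l (p : T) : supported TX (vdvd l) p -> exists q, p = tvar l * q.
Proof.
move=> pl; have pE : p = \sum_(mu <- msupp p) \sum_(nu <- msupp p@_mu)
    (p@_mu@_nu *: 'X_[nu]) *: 'X_[mu].
  by rewrite [LHS]mpolyE; apply: eq_bigr => mu _; rewrite -scaler_suml -mpolyE.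
suff H mu nu : exists q : T, (p@_mu@_nu *: 'X_[nu]) *: 'X_[mu] = tvar l * q.
  have sumH (I : Type) (r : seq I) (F : I -> T) :
      (forall i, exists q, F i = tvar l * q) -> exists q, \sum_(i <- r) F i = tvar l * q.
    move=> FH; apply: (big_ind (fun s => exists q, s = tvar l * q)) => //.
      by exists 0; rewrite mulr0.
    by move=> _ _ [q1 ->] [q2 ->]; exists (q1 + q2); rewrite mulrDr.
  by rewrite pE; apply: (sumH) => mu; apply: (sumH) => nu; apply: H.
have [c0|/(pl (mu, nu))] := eqVneq p@_mu@_nu 0.
  by exists 0; rewrite mulr0 c0 !scale0r.
move: (p@_mu@_nu) => c; case: l {pl} => [i|j] /=.
  move=> /eqP nui; exists ((c *: 'X_[(nu - U_(i))%MM]) *: 'X_[mu]).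
  rewrite mul_mpolyC scalerA -scalerAr -mpolyXD addmC submK //.
  by apply/mnm_lepP => k; rewrite mnm1E; case: eqP => [<-|//]; lia.
move=> /eqP muj; exists ((c *: 'X_[nu]) *: 'X_[(mu - U_(j))%MM]).
rewrite -scalerAr -mpolyXD addmC submK //.
by apply/mnm_lepP => k; rewrite mnm1E; case: eqP => [<-|//]; lia.
Qed.

Definition in_vars (B : seq var) (u : mono) : bool := has (vdvd^~ u) B.

Definition vars_ideal (B : seq var) : T -> Prop := supported TX (in_vars B).

Lemma vars_idealM B p q : vars_ideal B q -> vars_ideal B (p * q).
Proof.
move=> qB; apply: (supportedM (P := fun=> True) _ qB) => // u v _ /hasP[l lB lv].
by apply/hasP; exists l => //; rewrite vdvdD // lv orbT.
Qed.

Lemma vars_ideal_tvar B l q : l \in B -> vars_ideal B (tvar l * q).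
Proof.
move=> lB; rewrite mulrC; apply: vars_idealM => u /tvar_supp lu.
by apply/hasP; exists l.
Qed.

Lemma vars_ideal_nil p : vars_ideal [::] p -> p = 0.
Proof. by move=> p0; apply: (supported_disjoint (P := in_vars [::]) _ p0 p0). Qed.

Lemma vars_idealW (B C : seq var) p : {subset B <= C} -> vars_ideal B p -> vars_ideal C p.
Proof. by move=> BC; apply: supportedW => u /hasP[l /BC lC lu]; apply/hasP; exists l. Qed.

(** Together with [vars_ideal_regular] this says that the variables form a
    regular sequence; the quotient q is chosen homogeneous, as the induction on
    the sequence needs to control its degree. *)
Lemma vars_ideal_cons B l p : vars_ideal (l :: B) p ->
  exists q, vars_ideal B (p - tvar l * q) /\
    (forall a b, T_homog p a b -> T_homog q (a - xdeg l) (b - ydeg l)).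
Proof.
move=> plB; have [p1 p1E] := cf_filter TX (in_vars B) p.
have [|q qE] := @tvar_div l (p - p1).
  move=> u; rewrite cfB p1E; case: ifP => [_|uB]; first by rewrite subrr eqxx.
  by rewrite subr0 => /plB /= /orP[//|]; rewrite uB.
exists q; split.
  rewrite -qE subKr => u; rewrite p1E; case: ifP => //; by rewrite eqxx.
move=> a b /T_homogP hp; apply/T_homogP => u qu.
have : has_bideg a b (vmul l u).
  apply: hp; move: qu; rewrite -(tvarE l) -qE cfB p1E; case: ifP => _; last by rewrite subr0.
  by rewrite subrr eqxx.
case: l {plB qE} => i; rewrite /has_bideg /= mdegD mdeg1; lia.
Qed.

Lemma vars_ideal_regular B l q : l \notin B -> vars_ideal B (tvar l * q) -> vars_ideal B q.
Proof.
move=> lB lqB u; rewrite -(tvarE l) => /lqB /hasP[l' l'B l'u].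
apply/hasP; exists l' => //; move: l'u; have : l' != l by apply: contraNneq lB => <-.
case: l {lB lqB} => i; case: l' {l'B} => j //= ji; rewrite mnmDE mnm1E.
  by rewrite (negPf (_ : i != j)) ?addn0 // eq_sym; apply: contraNneq ji => ->.
by rewrite (negPf (_ : i != j)) ?addn0 // eq_sym; apply: contraNneq ji => ->.
Qed.

End VariableIdeals.

(** * Tor of a quotient by variables *)

Section KoszulVanishing.
Variables (K : fieldType) (n m : nat) (F : bigraded_free_resolution_of_K K n m).
Local Notation T := (Tring K n m).
Local Notation TX := (bipolynomials K n m).
Local Notation mono := ('X_{1..m} * 'X_{1..n})%type.
Local Notation var := ('I_n + 'I_m)%type.

Definition hom_row i (z : 'rV[T]_(rk F i)) (a b : int) : Prop :=
  forall j, T_homog (z 0 j) (a - (bdeg j).1) (b - (bdeg j).2).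

Definition T_cycle (P : T -> Prop) i : 'rV[T]_(rk F i) -> Prop :=
  match i with
  | 0 => fun=> True
  | i'.+1 => fun z => forall j, P ((z *m diff F i') 0 j)
  end.

Lemma diff_diff i (w : 'rV_(rk F i.+2)) : w *m diff F i.+1 *m diff F i = 0.
Proof. by apply/exact_S; exists w. Qed.

Lemma T_homogM p q a b c d : T_homog p a b -> T_homog q c d ->
  T_homog (p * q : T) (a + c) (b + d).
Proof.
move=> /T_homogP pab /T_homogP qcd; apply/T_homogP.
by apply: (supportedM pab qcd) => u v [] /= ? ? [] ? ?; split; rewrite /= mdegD; lia.
Qed.

Lemma T_homogB p q a b : T_homog p a b -> T_homog q a b -> T_homog (p - q : T) a b.
Proof. by move=> /T_homogP hp /T_homogP hq; apply/T_homogP; apply: supportedB. Qed.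

Lemma hom_rowB i (z w : 'rV_(rk F i)) a b : hom_row z a b -> hom_row w a b -> hom_row (z - w) a b.
Proof. by move=> hz hw j; rewrite !mxE; apply: T_homogB. Qed.

Lemma hom_row_diff i (z : 'rV_(rk F i.+1)) a b : hom_row z a b -> hom_row (z *m diff F i) a b.
Proof.
move=> hz k; rewrite mxE; apply/T_homogP; apply: supported_sum => j _.
apply/T_homogP; have := T_homogM (hz j) (@diff_homog _ _ _ F i j k).
by rewrite !addrA !subrK.
Qed.

Lemma hom_row_scale i (z : 'rV_(rk F i)) l a b :
  hom_row z (a - xdeg l) (b - ydeg l) -> hom_row (tvar K l *: z) a b.
Proof.
move=> hz k; rewrite mxE; have := T_homogM (@T_homog_tvar K n m l) (hz k).
have E (c d e : int) : d + (c - d - e) = c - e by lia.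
by rewrite !E.
Qed.

(** Exactness of a resolution yields an arbitrary preimage; its component of the
    right bidegree is again one, because the differential is homogeneous. *)
Lemma hom_lift i (v : 'rV_(rk F i)) (w : 'rV_(rk F i.+1)) a b :
  hom_row v a b -> v = w *m diff F i -> exists2 w', hom_row w' a b & v = w' *m diff F i.
Proof.
move=> hv vE.
pose Q j (u : mono) := (mdeg u.2 == a - (@bdeg _ _ _ F i.+1 j).1 :> int)
                       && (mdeg u.1 == b - (bdeg j).2 :> int).
have /fin_all_exists[g gP] j : exists g, supported TX (fun u => True /\ Q j u) g
    /\ supported TX (fun u => True /\ ~~ Q j u) (w 0 j - g).
  by have [//|g [h1 h2]] := @supported_filter _ _ _ TX (fun=> True) (Q j) (w 0 j); exists g.
pose w' := \row_j g j : 'rV[T]_(rk F i.+1).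
have hw' : hom_row w' a b.
  move=> j; rewrite mxE; apply/T_homogP; have [g1 _] := gP j.
  by apply: supportedW g1 => u [_ /andP[/eqP ? /eqP]].
exists w'; [exact: hw' | apply/eqP]; rewrite -subr_eq0; apply/eqP/rowP => k; rewrite [RHS]mxE.
apply: (@supported_disjoint _ _ _ TX (has_bideg (a - (bdeg k).1) (b - (bdeg k).2))
   (fun u => ~ has_bideg (a - (bdeg k).1) (b - (bdeg k).2) u)).
- by move=> u Pu; apply.
- by apply/T_homogP; apply: (hom_rowB hv (hom_row_diff hw')).
rewrite vE -mulmxBl mxE; apply: supported_sum => j _; rewrite !mxE.
have [_ g2] := gP j; have /T_homogP dh := @diff_homog _ _ _ F i j k.
apply: (supportedM g2 dh) => u v' [_ nQ] []; rewrite /has_bideg /= !mdegD => h1 h2 [h3 h4].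
by move/negP: nQ; apply; apply/andP; split; apply/eqP; lia.
Qed.

Lemma vars_ideal_mulmx B i k (z : 'rV[T]_i) (D : 'M_(i, k)) :
  (forall j, vars_ideal B (z 0 j)) -> forall j, vars_ideal B ((z *m D) 0 j).
Proof.
move=> zB j; rewrite mxE; apply: supported_sum => l _.
by rewrite mulrC; apply: vars_idealM.
Qed.

Lemma free_vanishing i (z : 'rV_(rk F i)) (a b : int) : (i%:Z < a) -> hom_row z a b ->
  T_cycle (vars_ideal [::]) z -> exists w, hom_row w a b /\ z = w *m diff F i.
Proof.
case: i z => [|i] z lia hz cz.
  have /exact_0[w zw] : (map_mx (@T_residue K n m) z *m aug F) 0 0 = 0.
    rewrite mxE big1 // => j _; rewrite !mxE.
    have [->|/aug_homog bj] := eqVneq (aug F j 0) 0; first by rewrite mulr0.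
    have := hz j; rewrite bj => /T_homogP hzj.
    have [->|/(hzj (0%MM, 0%MM))] := eqVneq (T_residue (z 0 j)) 0; first by rewrite mul0r.
    by rewrite /has_bideg /= mdeg0 => -[]; lia.
  by have [w' hw' zw'] := hom_lift hz zw; exists w'.
have /exact_S[w zw] : z *m diff F i = 0.
  by apply/rowP => j; rewrite [RHS]mxE; apply: vars_ideal_nil; apply: cz.
by have [w' hw' zw'] := hom_lift hz zw; exists w'.
Qed.

(** Tor_i(T / (B), K) vanishes in x-degrees above i.  For B empty this is the
    exactness of F.  To add a variable l, write dz = l q modulo B; as l is
    regular modulo B, q is a cycle of lower homological degree, and of x-degree
    lower by at most 1.  So q is a boundary, and after subtracting l times a
    preimage of q from z, a cycle modulo B remains. *)
Lemma koszul_vanishing (B : seq var) i (z : 'rV_(rk F i)) (a b : int) : uniq B -> (i%:Z < a) ->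
  hom_row z a b -> T_cycle (vars_ideal B) z ->
  exists w, hom_row w a b /\ forall j, vars_ideal B ((z - w *m diff F i) 0 j).
Proof.
elim: B => [|l B IHB] in i z a b *.
  move=> _ lia hz cz; have [w [hw zw]] := free_vanishing lia hz cz.
  by exists w; split=> // j; rewrite zw subrr mxE; apply: supported0.
case/andP=> lB uB ltia hz cz.
have up (p : T) : vars_ideal B p -> vars_ideal (l :: B) p.
  by apply: vars_idealW => k kB; rewrite inE kB orbT.
case: i => [|i] in z ltia hz cz *.
  have [w [hw zw]] := IHB 0%N z a b uB ltia hz I.
  by exists w; split=> // j; apply: up.
have /fin_all_exists[g gP] j := vars_ideal_cons (cz j).
pose q := \row_j g j : 'rV[T]_(rk F i).
have hq : hom_row q (a - xdeg l) (b - ydeg l).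
  move=> j; rewrite mxE; have [_ H] := gP j; have dz := hom_row_diff hz; have := H _ _ (dz j).
  have E (c d e : int) : c - d - e = c - e - d by lia.
  by rewrite E [in X in T_homog _ _ X]E.
have dq j : vars_ideal B ((z *m diff F i - tvar K l *: q) 0 j).
  by rewrite !mxE; have [] := gP j; rewrite !mxE.
clearbody q; clear g gP cz.
(* l q is dz minus an element of the ideal of B, and the differential of dz is
   zero; so l dq is in that ideal. *)
have cq : T_cycle (vars_ideal B) q.
  case: i => [|i] // in z q ltia hz hq dq * => j.
  apply: (vars_ideal_regular lB); have dd := vars_ideal_mulmx (D := diff F i) dq; move: (dd j).
  rewrite mulmxBl diff_diff sub0r -scalemxAl !mxE.
  by move/(@supportedN _ _ _ TX); rewrite opprK.
have [|w1 [hw1 qw1]] := IHB i q _ _ uB _ hq cq; first by case: (l) => ?; rewrite /xdeg; lia.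
have hz1 := hom_rowB hz (hom_row_scale hw1).
have cz1 : T_cycle (vars_ideal B) (z - tvar K l *: w1).
  move=> j; rewrite mulmxBl -scalemxAl.
  have -> : z *m diff F i - tvar K l *: (w1 *m diff F i) =
    (z *m diff F i - tvar K l *: q) + tvar K l *: (q - w1 *m diff F i).
    by rewrite scalerBr addrA subrK.
  rewrite mxE [in X in _ + X]mxE; apply: supportedD; first exact: dq.
  exact: vars_idealM.
have [w2 [hw2 zw2]] := IHB _ _ _ _ uB ltia hz1 cz1.
exists w2; split=> // j.
have -> : z - w2 *m diff F i.+1 = (z - tvar K l *: w1 - w2 *m diff F i.+1) + tvar K l *: w1.
  by rewrite addrAC subrK.
rewrite mxE; apply: supportedD; first exact/up/zw2.
by rewrite mxE; apply: vars_ideal_tvar; rewrite inE eqxx.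
Qed.

End KoszulVanishing.

(** * The map onto the Rees algebra *)

Section ReesMap.
Variables (K : fieldType) (n : nat) (G : sgraph n).
Local Notation m := #|edges G|.
Local Notation S := {mpoly K[n]}.
Local Notation T := (Tring K n m).
Local Notation TX := (bipolynomials K n m).
Local Notation A := {poly {mpoly K[n]}}.
Local Notation AX := (tpolynomials K n).
Local Notation tmono := (nat * 'X_{1..n})%type.
Local Notation phi := (@rees_map K n G).

Definition compm (j : 'I_m) : 'X_{1..n} := [multinom (i \notin edge j : nat) | i < n].

Lemma comp_genE j : comp_gen K j = 'X_[compm j].
Proof.
rewrite /comp_gen mpolyXE_id big_mkcond /=; apply: eq_bigr => i _.
by rewrite mnmE; case: (i \notin edge j).
Qed.

Lemma mdeg_compm j : (mdeg (compm j))%:Z = n%:Z - 2.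
Proof.
suff : (mdeg (compm j) + 2 = n)%N by lia.
rewrite mdegE; under eq_bigr do rewrite mnmE.
rewrite -(card_edge j) -sum1_card [X in (_ + X)%N]big_mkcond -big_split /=.
rewrite -[RHS]card_ord -sum1_card; apply: eq_bigr => i _.
by case: (i \in edge j).
Qed.

Lemma phiC (q : S) : phi q%:MP = q%:P.
Proof. exact: mmapC. Qed.

Lemma phiM p q : phi (p * q) = phi p * phi q.
Proof. exact: (rmorphM (mmap polyC (fun j : 'I_m => (comp_gen K j)%:P * 'X))). Qed.

Lemma phiB p q : phi (p - q) = phi p - phi q.
Proof. exact: raddfB. Qed.

Lemma phi_sum (I : Type) (r : seq I) (P : pred I) (f : I -> T) :
  phi (\sum_(i <- r | P i) f i) = \sum_(i <- r | P i) phi (f i).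
Proof. exact: raddf_sum. Qed.

(** The x-part of the image of y^mu. *)
Definition umon (mu : 'X_{1..m}) : 'X_{1..n} := (\sum_j compm j *+ mu j)%MM.

Lemma mdeg_sub p (mu : 'X_{1..p}) j : mu j != 0%N -> mdeg mu = (mdeg (mu - U_(j))%MM).+1.
Proof. by move=> muj; rewrite -[in LHS](@submK _ U_(j)%MM mu) ?lep1mP // mdegD mdeg1 addn1. Qed.

Lemma umon_sub (mu : 'X_{1..m}) j : mu j != 0%N -> umon mu = (umon (mu - U_(j)) + compm j)%MM.
Proof.
move=> muj; rewrite -[in LHS](@submK _ U_(j)%MM mu) ?lep1mP // /umon.
under eq_bigr do rewrite mnmDE mnm1E.
rewrite (bigD1 j) //= [in RHS](bigD1 j) //= eqxx.
rewrite addn1 mulmSr -!addmA; congr (_ + _)%MM; rewrite addmC; congr (_ + _)%MM.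
by apply: eq_bigr => l /negPf; rewrite eq_sym => ->; rewrite addn0.
Qed.

Lemma phi_mmap1 (mu : 'X_{1..m}) :
  mmap1 (fun j => (comp_gen K j)%:P * 'X) mu = 'X_[umon mu]%:P * 'X^(mdeg mu) :> A.
Proof.
rewrite /mmap1 /umon mdegE -mprodXE rmorph_prod -prodrXr -big_split /=.
by apply: eq_bigr => j _; rewrite exprMn comp_genE -rmorphXn /= mpolyXn.
Qed.

Lemma phi_supp p : supported AX
  (fun u => exists v, [/\ cf TX p v != 0, u.1 = mdeg v.1 & u.2 = (v.2 + umon v.1)%MM]) (phi p).
Proof.
rewrite /rees_map /mmap; apply: supported_sum => mu _ [k al].
rewrite phi_mmap1 mulrA -rmorphM /= coefCM coefXn.
case: (k =P mdeg mu) => [->|_]; last by rewrite mulr0 mcoeff0 eqxx.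
rewrite mulr1 => /mcoeffM_neq0[nu [ga [pnu]]].
rewrite mcoeffX; case: (umon mu =P ga) => [<- _ ->|_]; last by rewrite eqxx.
by exists (mu, nu).
Qed.

Lemma phi_coef0 p : (phi p)`_0 = p@_0%MM.
Proof.
rewrite /rees_map /mmap coef_sum.
have E mu : ((p@_mu)%:P * mmap1 (fun j => (comp_gen K j)%:P * 'X) mu : A)`_0
   = if mu == 0%MM then p@_mu else 0.
  rewrite phi_mmap1 mulrA -rmorphM /= coefCM coefXn eq_sym mdeg_eq0.
  by case: eqP => [->|_]; rewrite ?mulr0 // /umon big1 ?mpolyX0 ?mulr1 // => j _; rewrite mnm0E mulm0n.
under eq_bigr do rewrite E.
have [p0|p0] := boolP (0%MM \in msupp p).
  rewrite (bigD1_seq 0%MM) ?msupp_uniq //= eqxx big1 ?addr0 // => mu /negPf->//.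
rewrite (memN_msupp_eq0 p0) big1_seq // => mu /= mup.
by case: eqP mup p0 => // -> ->.
Qed.

Definition T_stable (P : tmono -> bool) : Prop :=
  (forall k al i, P (k, al) -> P (k, al + U_(i))%MM) /\
  (forall k al j, P (k, al) -> P (k.+1, al + compm j)%MM).

Lemma T_stable_mul P k al mu nu : T_stable P -> P (k, al) ->
  P ((k + mdeg mu)%N, (al + (nu + umon mu))%MM).
Proof.
move=> [Px Py] Pal.
have Pnu : P (k, (al + nu)%MM).
  have [d] := ubnP (mdeg nu); elim: d => // d IH in nu *; rewrite ltnS => led.
  have [/forallP nu0|] := boolP [forall i, nu i == 0%N].
    suff -> : nu = 0%MM by rewrite addm0.
    by apply/mnmP => i; rewrite mnm0E; apply/eqP.
  rewrite negb_forall => /existsP[i nui].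
  have nuE : nu = (nu - U_(i) + U_(i))%MM by rewrite submK // lep1mP.
  rewrite nuE addmA; apply: Px; apply: IH; apply: leq_trans led.
  by rewrite [X in (_ < mdeg X)%N]nuE mdegD mdeg1 addn1.
rewrite addmA; move: (al + nu)%MM Pnu => {Pal}{}al Pal.
have [d] := ubnP (mdeg mu); elim: d => // d IH in mu *; rewrite ltnS => led.
have [/forallP mu0|] := boolP [forall j, mu j == 0%N].
  have -> : mu = 0%MM by apply/mnmP => i; rewrite mnm0E; apply/eqP.
  by rewrite mdeg0 addn0 /umon big1 ?addm0 // => j _; rewrite mnm0E mulm0n.
rewrite negb_forall => /existsP[j muj].
rewrite (umon_sub muj) (mdeg_sub muj) addmA addnS; apply: Py; apply: IH.
by apply: leq_trans led; rewrite (mdeg_sub muj).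
Qed.

Lemma T_stable_phi P p f : T_stable P -> supported AX P f -> supported AX P (phi p * f).
Proof.
move=> Pst Pf; apply: (supportedM (@phi_supp p) Pf) => -[k al] [k' al'] [[mu nu] /= [_ -> ->]].
by move=> Pal; rewrite addnC addmC; apply: T_stable_mul.
Qed.

Definition t_bideg (a b : int) (u : tmono) : Prop :=
  (mdeg u.2)%:Z + u.1%:Z * (2 - n%:Z) = a /\ u.1%:Z = b.

Lemma rees_homogP (f : A) a b : rees_homog f a b <-> supported AX (t_bideg a b) f.
Proof.
split=> [hf [k nu]|hf k nu]; first by rewrite /= -mcoeff_msupp => /hf.
by rewrite mcoeff_msupp => nz; have := hf (k, nu) nz.
Qed.

Lemma phi_homog (p : T) a b : T_homog p a b -> rees_homog (phi p) a b.
Proof.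
move=> /T_homogP hp; apply/rees_homogP.
apply: supportedW (@phi_supp p) => -[k al] [[mu nu] /= [pu -> ->]].
have [/= <- <-] := hp (mu, nu) pu; split=> //=; rewrite mdegD PoszD.
have -> : (mdeg (umon mu))%:Z = (mdeg mu)%:Z * (n%:Z - 2).
  rewrite /umon mdeg_sum mdegE !(big_morph Posz PoszD (erefl _)) mulr_suml; apply: eq_bigr => j _.
  by rewrite mdegMn PoszM mdeg_compm mulrC.
by rewrite -addrA -mulrDr [X in _ * X](_ : _ = 0) ?mulr0 ?addr0 //; lia.
Qed.

End ReesMap.

(** * Subquotients spanned by monomials *)

Section Pieces.
Variables (K : fieldType) (n : nat) (G : sgraph n).
Local Notation m := #|edges G|.
Local Notation S := {mpoly K[n]}.
Local Notation T := (Tring K n m).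
Local Notation A := {poly {mpoly K[n]}}.
Local Notation AX := (tpolynomials K n).
Local Notation tmono := (nat * 'X_{1..n})%type.
Local Notation phi := (@rees_map K n G).
Variable F : bigraded_free_resolution_of_K K n m.

Definition hom_rowA i (z : 'rV[A]_(rk F i)) (a b : int) : Prop :=
  forall j, rees_homog (z 0 j) (a - (bdeg j).1) (b - (bdeg j).2).

Definition A_cycle (P : A -> Prop) i : 'rV[A]_(rk F i) -> Prop :=
  match i with
  | 0 => fun=> True
  | i'.+1 => fun z => forall j, P ((z *m map_mx phi (diff F i')) 0 j)
  end.

(** For monomial T-submodules Q <= P of S[t]: the homology of F tensored with
    P / Q is zero in homological degree i and x-degree a when a - i > r.  The
    bounding chain w is required to be homogeneous so that such statements can
    be chained along a filtration. *)
Definition vanishing_above (r : int) (P Q : tmono -> bool) : Prop :=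
  forall i (z : 'rV[A]_(rk F i)) (a b : int), i%:Z + r < a -> hom_rowA z a b ->
    (forall j, supported AX P (z 0 j)) -> A_cycle (supported AX Q) z ->
  exists w : 'rV[A]_(rk F i.+1), [/\ hom_rowA w a b, forall j, supported AX P (w 0 j)
    & forall j, supported AX Q ((z - w *m map_mx phi (diff F i)) 0 j)].

Lemma map_phi_mul i k (w : 'rV[T]_i) (D : 'M[T]_(i, k)) :
  map_mx phi w *m map_mx phi D = map_mx phi (w *m D).
Proof.
apply/rowP => j; rewrite !mxE phi_sum; apply: eq_bigr => l _.
by rewrite !mxE phiM.
Qed.

Lemma diff_diffA i (w : 'rV[A]_(rk F i.+2)) :
  w *m map_mx phi (diff F i.+1) *m map_mx phi (diff F i) = 0.
Proof.
rewrite -mulmxA; suff -> : map_mx phi (diff F i.+1) *m map_mx phi (diff F i) = 0.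
  by rewrite mulmx0.
apply/row_matrixP => k; rewrite row0 row_mul -map_row map_phi_mul.
rewrite rowE diff_diff; apply/rowP => j; rewrite !mxE.
exact: raddf0.
Qed.

Lemma supported_mulmx (P : tmono -> bool) i k (z : 'rV[A]_i) (D : 'M[T]_(i, k)) : T_stable G P ->
  (forall j, supported AX P (z 0 j)) -> forall j, supported AX P ((z *m map_mx phi D) 0 j).
Proof.
move=> Pst zP j; rewrite mxE; apply: supported_sum => l _.
by rewrite mulrC mxE; apply: T_stable_phi.
Qed.

Lemma rees_homogM (f g : A) a b c d : rees_homog f a b -> rees_homog g c d ->
  rees_homog (f * g) (a + c) (b + d).
Proof.
move=> /rees_homogP fab /rees_homogP gcd; apply/rees_homogP.
apply: (supportedM fab gcd) => u v [h1 h2] [h3 h4]; split; rewrite /= ?mdegD ?PoszD ?mulrDl; lia.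
Qed.

Lemma rees_homogD (f g : A) a b : rees_homog f a b -> rees_homog g a b -> rees_homog (f + g) a b.
Proof. by move=> /rees_homogP hp /rees_homogP hq; apply/rees_homogP; apply: supportedD. Qed.

Lemma rees_homogN (f : A) a b : rees_homog f a b -> rees_homog (- f) a b.
Proof. by move=> /rees_homogP hp; apply/rees_homogP; apply: supportedN. Qed.

Lemma hom_rowAD i (z w : 'rV_(rk F i)) a b :
  hom_rowA z a b -> hom_rowA w a b -> hom_rowA (z + w) a b.
Proof. by move=> hz hw j; rewrite !mxE; apply: rees_homogD. Qed.

Lemma hom_rowAN i (z : 'rV_(rk F i)) a b : hom_rowA z a b -> hom_rowA (- z) a b.
Proof. by move=> hz j; rewrite !mxE; apply: rees_homogN. Qed.

Lemma hom_rowA_diff i (z : 'rV_(rk F i.+1)) a b :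
  hom_rowA z a b -> hom_rowA (z *m map_mx phi (diff F i)) a b.
Proof.
move=> hz k; rewrite mxE; apply/rees_homogP; apply: supported_sum => j _.
apply/rees_homogP; rewrite mxE.
have := rees_homogM (hz j) (phi_homog (@diff_homog _ _ _ F i j k)).
by rewrite !addrA !subrK.
Qed.

Lemma vanishing_above_refl r (P Q : tmono -> bool) : (forall u, P u -> Q u) -> vanishing_above r P Q.
Proof.
move=> PQ i z a b _ _ zP _; exists 0; split=> j.
- by rewrite mxE; apply/rees_homogP; apply: supported0.
- by rewrite mxE; apply: supported0.
- by rewrite mul0mx subr0; apply: supportedW (zP j).
Qed.

(** The middle term of the long exact homology sequence of L / Q, P / Q and
    P / L. *)
Lemma vanishing_above_trans r (P L Q : tmono -> bool) : T_stable G Q ->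
  (forall u, Q u -> L u) -> (forall u, L u -> P u) ->
  vanishing_above r P L -> vanishing_above r L Q -> vanishing_above r P Q.
Proof.
move=> Qst QL LP vPL vLQ i z a b lta hz zP cz.
have [|w1 [hw1 w1P zw1]] := vPL i z a b lta hz zP.
  by case: i z cz {lta hz zP} => [|i] z // cz j; apply: supportedW (cz j).
(* The differential of z1 is that of z, hence still in Q. *)
pose z1 := z - w1 *m map_mx phi (diff F i).
have hz1 : hom_rowA z1 a b by apply: hom_rowAD => //; apply/hom_rowAN/hom_rowA_diff.
have [|w2 [hw2 w2L zw2]] := vLQ i z1 a b lta hz1 zw1.
  case: i z w1 cz @z1 {lta hz zP hw1 w1P zw1 hz1} => [|i] z w1 cz //= j.
  by rewrite mulmxBl diff_diffA subr0; apply: cz.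
exists (w1 + w2); split=> [|j|j]; first exact: hom_rowAD.
  by rewrite mxE; apply: supportedD => //; apply: supportedW (w2L j).
by rewrite mulmxDl opprD addrA; apply: zw2.
Qed.

Lemma mpoly_div n' (f : {mpoly K[n']}) (ga : 'X_{1..n'}) :
  (forall al, f@_al != 0 -> (ga <= al)%MM) -> exists q, f = q * 'X_[ga].
Proof.
move=> fga; exists (\sum_(al <- msupp f) f@_al *: 'X_[(al - ga)%MM]).
rewrite mulr_suml [LHS]mpolyE big_seq [RHS]big_seq; apply: eq_bigr => al.
by rewrite mcoeff_msupp => /fga le; rewrite -scalerAl -mpolyXD submK.
Qed.

(** In this section P / Q is generated by the class of x^ga t^k.  Its annihilator
    is generated by all the y_j and by the x_v with x_v x^ga t^k in Q, collected
    in B, so P / Q is a shifted copy of T / (B). *)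
Section Piece.
Variables (r : int) (P Q : tmono -> bool) (k : nat) (ga : 'X_{1..n}).
Hypotheses (Pst : T_stable G P) (Qst : T_stable G Q).
Hypothesis Pga : P (k, ga).
Hypothesis PQ : forall l al, P (l, al) -> Q (l, al) \/ l = k /\ (ga <= al)%MM.
Hypothesis Qy : forall j : 'I_m, Q (k.+1, (ga + compm j)%MM).
Hypothesis Qcolon : forall de, Q (k, (ga + de)%MM) ->
  exists2 v, de v != 0%N & Q (k, (ga + U_(v))%MM).
Hypothesis le_r : (mdeg ga)%:Z + k%:Z * (2 - n%:Z) <= r.

Let B : seq ('I_n + 'I_m) :=
  [seq inl v | v <- enum 'I_n & Q (k, ga + U_(v))%MM] ++ [seq inr j | j <- enum 'I_m].

Let uniqB : uniq B.
Proof.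
rewrite cat_uniq; apply/and3P; split.
- by rewrite map_inj_uniq => [|? ? []//]; apply/filter_uniq/enum_uniq.
- by apply/hasPn => _ /mapP[j _ ->]; apply/negP => /mapP[].
- by rewrite map_inj_uniq => [|? ? []//]; apply: enum_uniq.
Qed.

Let g : A := 'X_[ga]%:P * 'X^k.

Let g_homog : rees_homog g ((mdeg ga)%:Z + k%:Z * (2 - n%:Z)) k.
Proof.
apply/rees_homogP => -[l al] /=; rewrite coefCM coefXn.
case: (l =P k) => [->|_]; last by rewrite mulr0 mcoeff0 eqxx.
by rewrite mulr1 mcoeffX; case: (ga =P al) => [<-|_]; rewrite ?eqxx.
Qed.

Let mulgE (f : A) l al : (f * g)`_(k + l)@_(ga + al)%MM = f`_l@_al.
Proof.
by rewrite /g mulrA coefMXn ltnNge leq_addr /= addKn coefMC addmC mulrC mcoeffXM.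
Qed.

Let g_supp : supported AX (fun u => u = (k, ga)) g.
Proof.
move=> [l al] /=; rewrite coefCM coefXn.
case: (l =P k) => [->|_]; last by rewrite mulr0 mcoeff0 eqxx.
by rewrite mulr1 mcoeffX; case: (ga =P al) => [<-|_]; rewrite ?eqxx.
Qed.

Let phig_supp p : vars_ideal B p -> supported AX Q (phi p * g).
Proof.
move=> pB; apply: (supportedM (@phi_supp K n G p) g_supp) => -[l al] u [[mu nu] /= [pu -> ->]] ->.
have /hasP[x xB xu] := pB (mu, nu) pu; move: xB; rewrite mem_cat /=.
case/orP=> /mapP[v].
  rewrite mem_filter => /andP[Qv _] xv; move: xu; rewrite xv /= => nuv.
  have := T_stable_mul mu (nu - U_(v)) Qst Qv.
  rewrite addnC; congr (is_true (Q (_, _))); apply/mnmP => i.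
  by rewrite !mnmDE mnmBE mnm1E; case: (v =P i) => [<-|_] /=; lia.
move=> _ xj; move: xu; rewrite xj /= => muj.
have := T_stable_mul (mu - U_(v)) nu Qst (Qy v).
rewrite (umon_sub muj) (mdeg_sub muj).
have -> : (k.+1 + mdeg (mu - U_(v)) = (mdeg (mu - U_(v))).+1 + k)%N by lia.
congr (is_true (Q (_, _))); apply/mnmP => i; rewrite !mnmDE.
by rewrite [RHS]addnC -addnA; congr addn; rewrite addnCA; congr addn; rewrite addnC.
Qed.

Let phig_supp_inv p : supported AX Q (phi p * g) -> vars_ideal B p.
Proof.
move=> pgQ [mu nu] pu; apply/hasP.
have [/forallP mu0|] := boolP [forall j, mu j == 0%N]; last first.
  rewrite negb_forall => /existsP[j muj]; exists (inr j) => //.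
  by rewrite mem_cat map_f ?orbT ?mem_enum.
have mu0E : mu = 0%MM by apply/mnmP => j; rewrite mnm0E; apply/eqP.
have /Qcolon[v nuv Qv] : Q (k, (ga + nu)%MM).
  apply: pgQ; rewrite /= -[X in _`_X]addn0 mulgE phi_coef0.
  by move: pu; rewrite /= mu0E.
exists (inl v) => //.
by rewrite mem_cat map_f // mem_filter Qv mem_enum.
Qed.

Let split_piece f a b : supported AX P f -> rees_homog f a b -> exists p,
  T_homog p (a - ((mdeg ga)%:Z + k%:Z * (2 - n%:Z))) (b - k%:Z)
  /\ supported AX Q (f - phi p * g).
Proof.
move=> fP hf; have [f1 f1E] := cf_filter AX (fun u => ~~ Q u) f.
have f1s l al : f1`_l@_al != 0 -> [/\ l = k, (ga <= al)%MM & f`_l@_al != 0].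
  have := f1E (l, al); rewrite /= => ->; case: ifP => [nQ nz|]; last by rewrite eqxx.
  by have [Ql|[lk le]] := PQ (fP (l, al) nz); [rewrite Ql in nQ | split].
have [|q qE] := @mpoly_div _ f1`_k ga; first by move=> al /f1s[].
exists q%:MP; split.
  apply/T_homogP => -[mu nu] /=; rewrite mcoeffC.
  case: (mu =P 0%MM) => [->|_]; last by rewrite mulr0 mcoeff0 eqxx.
  rewrite mulr1 => qnu; have : f1`_k@_(nu + ga)%MM != 0 by rewrite qE mulrC mcoeffXM.
  case/f1s => _ _ nz; have /rees_homogP hf' := hf.
  have [/=] := hf' (k, (nu + ga)%MM) nz; rewrite mdegD PoszD /has_bideg /= mdeg0; lia.
have -> : phi q%:MP * g = f1.
  rewrite phiC /g mulrA -rmorphM /= -qE; apply/polyP => l; rewrite coefCM coefXn.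
  case: eqP => [->|/eqP lk]; first by rewrite mulr1.
  rewrite mulr0; apply/mpolyP => al; rewrite mcoeff0; apply/eqP; rewrite eq_sym.
  by apply: contraR lk => /f1s[->].
by move=> u; rewrite cfB f1E; case: (Q u); rewrite //= subrr eqxx.
Qed.

Lemma piece_vanishing : vanishing_above r P Q.
Proof.
move=> i z a b lta hz zP cz; set s := (mdeg ga)%:Z + k%:Z * (2 - n%:Z).
have /fin_all_exists[h hP] j := split_piece (zP j) (hz j).
pose p := \row_j h j : 'rV[T]_(rk F i).
have hp : hom_row p (a - s) (b - k%:Z).
  move=> j; rewrite mxE; have [+ _] := hP j.
  have E (c d e : int) : c - d - e = c - e - d by lia.
  by rewrite E [in X in T_homog _ _ X]E.
pose zp := z - g *: map_mx phi p.
have zpQ j : supported AX Q (zp 0 j).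
  by rewrite !mxE mulrC; have [] := hP j.
clearbody p; clear h hP.
have cp : T_cycle (vars_ideal B) p.
  case: i => [|i] // in z p lta hz zP cz hp zp zpQ *.
  move=> j; apply: phig_supp_inv.
  have -> : phi ((p *m diff F i) 0 j) * g =
    ((z *m map_mx phi (diff F i)) 0 j) - ((zp *m map_mx phi (diff F i)) 0 j).
    rewrite /zp mulmxBl -scalemxAl map_phi_mul.
    move: (z *m map_mx phi (diff F i)) (p *m diff F i) => M N.
    by rewrite !mxE subKr mulrC.
  by apply: supportedB; [exact: cz | have := supported_mulmx (D := diff F i) Qst zpQ; apply].
have lts : i%:Z < a - s by lia.
have [w [hw wB]] := koszul_vanishing uniqB lts hp cp.
exists (g *: map_mx phi w); split=> j.
- rewrite !mxE; have := rees_homogM g_homog (phi_homog (hw j)).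
  have E (c d e : int) : d + (c - d - e) = c - e by lia.
  by rewrite !E.
- rewrite !mxE mulrC; apply: T_stable_phi => //.
  by apply: supportedW g_supp => _ ->.
have -> : z - g *: map_mx phi w *m map_mx phi (diff F i) =
   zp + g *: map_mx phi (p - w *m diff F i).
  have -> : map_mx phi (p - w *m diff F i) = map_mx phi p - map_mx phi (w *m diff F i).
    by apply/rowP => l; rewrite !mxE phiB.
  by rewrite -scalemxAl map_phi_mul scalerBr addrA subrK.
rewrite mxE; apply: supportedD; first exact: zpQ.
by rewrite !mxE mulrC; apply: phig_supp; have := wB j; rewrite !mxE.
Qed.

End Piece.

End Pieces.

(** * A filtration of the Rees algebra *)

Section ReesMonomials.
Variables (n : nat) (G : sgraph n).
Local Notation m := #|edges G|.
Local Notation tmono := (nat * 'X_{1..n})%type.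

(** For the pair (k, al) this is membership of x^al t^k in the Rees algebra, see
    [reesP]. *)
Definition in_rees (u : tmono) : bool :=
  [exists E : u.1.-tuple 'I_m, [forall v, (u.1 <= u.2 v + vdeg E v)%N]].

Lemma in_reesP k (al : 'X_{1..n}) : reflect
  (exists E : seq 'I_m, size E = k /\ forall v, (k <= al v + vdeg E v)%N) (in_rees (k, al)).
Proof.
apply: (iffP existsP) => [[E /forallP leE]|[E [szE leE]]].
  by exists E; rewrite size_tuple.
have szE' : size E == k by rewrite szE.
by exists (Tuple szE'); apply/forallP => v /=; apply: leE.
Qed.

Lemma compmE (j : 'I_m) v : (compm j v + (v \in edge j) = 1)%N.
Proof. by rewrite mnmE; case: (v \in edge j). Qed.

Lemma T_stable_in_rees : T_stable G in_rees.
Proof.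
split=> k al i /in_reesP[E [szE leE]]; apply/in_reesP.
  exists E; split=> // v; apply: leq_trans (leE v) _.
  by rewrite mnmDE addnAC leq_addr.
exists (i :: E); split=> [|v]; first by rewrite /= szE.
by rewrite mnmDE vdeg_cons addnA -(addnA (al v)) compmE addnAC addn1 ltnS; apply: leE.
Qed.

Definition rees_ge k (u : tmono) : bool := (k <= u.1)%N && in_rees u.

Lemma T_stable_rees_ge k : T_stable G (rees_ge k).
Proof.
have [Rx Ry] := T_stable_in_rees.
split=> l al i /andP[/= kl Ru]; apply/andP; split; rewrite //=.
- exact: Rx.
- exact: leqW.
- exact: Ry.
Qed.

Section Generators.
Variable k : nat.

Definition roots : {set 'I_n} := [set v | is_root G v].

Local Notation gen := (k.-tuple 'I_m * {set 'I_n})%type.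

Definition genm (g : gen) : 'X_{1..n} :=
  [multinom (k - vdeg g.1 v + (v \in g.2))%N | v < n].

Definition gen_le (g h : gen) : bool :=
  (degm h.1 < degm g.1)%O || ((degm g.1 == degm h.1) && (#|h.2| <= #|g.2|)%N).

Definition gens : seq gen := sort gen_le (filter (fun g : gen => g.2 \subset roots) (enum {: gen})).

Lemma mem_gens g : (g \in gens) = (g.2 \subset roots).
Proof. by rewrite mem_sort mem_filter mem_enum andbT. Qed.

Lemma gen_le_refl : reflexive gen_le.
Proof. by move=> g; rewrite /gen_le eqxx leqnn orbT. Qed.

Lemma gen_le_total : total gen_le.
Proof.
move=> g h; rewrite /gen_le; case: (ltgtP (degm g.1) (degm h.1)) => //= _.
exact: leq_total.
Qed.

Lemma gen_le_trans : transitive gen_le.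
Proof.
move=> h g f; rewrite /gen_le.
case: (ltgtP (degm g.1) (degm h.1)) => //= [lt_gh _|eq_gh le1].
  case: (ltgtP (degm h.1) (degm f.1)) => //= [lt_hf _|eq_hf _].
    by rewrite (lt_trans lt_hf lt_gh).
  by rewrite -eq_hf lt_gh.
rewrite eq_gh; case: (ltgtP (degm h.1) (degm f.1)) => //= _ le2.
exact: leq_trans le2 le1.
Qed.

Lemma vdeg_le (E : k.-tuple 'I_m) v : (vdeg E v <= k)%N.
Proof. by rewrite -[X in (_ <= X)%N](size_tuple E) count_size. Qed.

Lemma in_rees_genm g : in_rees (k, genm g).
Proof.
apply/in_reesP; exists g.1; rewrite size_tuple; split=> // v.
by rewrite mnmE addnAC subnK ?leq_addr ?vdeg_le.
Qed.

Lemma genm_multiple_in_rees g al : (genm g <= al)%MM -> in_rees (k, al).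
Proof.
move=> /mnm_lepP le; have /in_reesP[E [szE leE]] := in_rees_genm g.
apply/in_reesP; exists E; split=> // v; apply: leq_trans (leE v) _.
by rewrite leq_add2r.
Qed.

(** Including all of t-degree more than k makes this T-stable for every s, as the
    y_j raise the t-degree. *)
Definition lower (s : seq gen) (u : tmono) : bool :=
  rees_ge k.+1 u || ((u.1 == k) && has (fun g => (genm g <= u.2)%MM) s).

Lemma lower_in_rees s u : lower s u -> in_rees u.
Proof.
case: u => l al /orP[/andP[]//|/andP[/= /eqP-> /hasP[g _]]].
exact: genm_multiple_in_rees.
Qed.

Lemma T_stable_lower s : T_stable G (lower s).
Proof.
have [Rx Ry] := T_stable_rees_ge k.+1.
split=> l al i; last first.
  move=> low; have Ral := lower_in_rees low.
  apply/orP; left; apply/andP; split; last exact: (T_stable_in_rees.2).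
  by case/orP: low => [/andP[/= kl _]|/andP[/= /eqP-> _]] //; apply: leqW.
case/orP=> [/Rx H|/andP[/= lk /hasP[g gs le]]]; first by rewrite /lower H.
rewrite /lower /= lk; apply/orP; right; apply/hasP; exists g => //.
exact: (lepm_trans le (lem_addr _ _)).
Qed.

Lemma lower_nilE u : lower [::] u = rees_ge k.+1 u.
Proof. by rewrite /lower /= andbF orbF. Qed.

Lemma lower_gens u : lower gens u = rees_ge k u.
Proof.
apply/idP/idP => [low|/andP[ku Ru]].
  rewrite /rees_ge (lower_in_rees low) andbT.
  by case/orP: low => [/andP[/ltnW]//|/andP[/eqP->]].
rewrite /lower /rees_ge; case: u => l al /= in ku Ru *.
case: (ltngtP k l) ku => //= kl _; first by rewrite Ru.
subst l.
have /in_reesP[E [szE leE]] := Ru; have szE' : size E == k by rewrite szE.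
apply/hasP; exists (Tuple szE', set0); first by rewrite mem_gens sub0set.
by apply/mnm_lepP => v; rewrite mnmE inE addn0 leq_subLR addnC; apply: leE.
Qed.

(** The largest vertex has no larger neighbour. *)
Lemma card_roots (T : {set 'I_n}) : (0 < n)%N -> T \subset roots -> (#|T| <= n.-1)%N.
Proof.
move=> n_gt0 Troots; have -> : n.-1 = #|[set~ (Ordinal (ltac:(by rewrite prednK) : (n.-1 < n)%N))]|.
  by rewrite cardsC1 card_ord.
apply: subset_leq_card; apply/subsetP => v /(subsetP Troots).
rewrite !inE => /andP[/existsP[w vw] /forallP/(_ w)]; rewrite vw /= => ltvw.
by apply: contraTneq ltvw => ->; rewrite -leqNgt /=; have := ltn_ord w; lia.
Qed.

(** The left-hand side is the x-degree of the monomial of g times t^k, since t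
    has x-degree 2 - n. *)
Lemma mdeg_genm (g : gen) : (mdeg (genm g))%:Z + k%:Z * (2 - n%:Z) = #|g.2|%:Z.
Proof.
suff : (mdeg (genm g) + 2 * k = n * k + #|g.2|)%N by lia.
rewrite -[in LHS](size_tuple g.1) -sum_vdeg mdegE -big_split /=.
have -> : (n * k + #|g.2| = \sum_(v < n) (k + (v \in g.2)))%N.
  rewrite big_split /= sum_nat_const card_ord; congr addn.
  by rewrite -sum1_card big_mkcond; apply: eq_bigr => v _; case: ifP.
by apply: eq_bigr => v _; rewrite mnmE addnAC subnK ?vdeg_le.
Qed.

(** Let x^de x^(k - deg E) x_T be a multiple of an earlier generator, given by
    (F, T').  If F and E have the same degrees, de contains some root i in T'
    and not in T, and x_i times the generator is that of (E, i |: T).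
    Otherwise [lex_exchange] gives an earlier E2.  Whatever is missing for
    divisibility by the generator of E2 is supplied by x_T and x^de together,
    and not by x_T alone, since the generator of (E, T) is not redundant.  When
    E2 is short by one vertex u, this makes u occur in de.  When E2 is short by
    a root u and by x, either u is not in T, and x_u leads to (E, u |: T) as
    before, or x_T supplies u and de supplies x. *)
Lemma colon_by_variables_aux (s : seq gen) (E F : k.-tuple 'I_m) (T T' : {set 'I_n})
    (de : 'X_{1..n}) :
  (forall h : gen, h.2 \subset roots -> ~~ gen_le (E, T) h -> h \in s) ->
  T \subset roots -> T' \subset roots -> (F, T') \in s -> gen_le (F, T') (E, T) ->
  (genm (F, T') <= genm (E, T) + de)%MM -> ~~ lower s (k, genm (E, T)) ->
  exists2 v, de v != 0%N & lower s (k, genm (E, T) + U_(v))%MM.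
Proof.
move=> slt groots hroots hs hg /mnm_lepP hle ng.
have lowI (h : gen) (al : 'X_{1..n}) : h \in s -> (genm h <= al)%MM -> lower s (k, al).
  by move=> hs' le; rewrite /lower /= eqxx; apply/orP; right; apply/hasP; exists h.
have vE w : (vdeg E w <= k)%N by apply: vdeg_le.
have dle w : (k - vdeg F w + (w \in T') <= k - vdeg E w + (w \in T) + de w)%N.
  by have := hle w; rewrite mnmDE !mnmE.
have addT v : v \in roots -> v \notin T -> lower s (k, genm (E, T) + U_(v))%MM.
  move=> vr vT; apply: (lowI (E, v |: T)).
    apply: slt; first by rewrite subUset sub1set vr.
    by rewrite /gen_le /= ltxx eqxx /= -ltnNge cardsU1 vT.
  apply/mnm_lepP => w; rewrite mnmDE mnm1E !mnmE /= !inE [v == w]eq_sym.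
  by case: eqP => [->|_]; rewrite ?(negPf vT) //= addn0.
have rootsP v : is_root G v -> v \in roots by rewrite inE.
have [ltEF|] := boolP (degm E < degm F)%O; last first.
  move: hg; rewrite /gen_le /= => /orP[-> //|/andP[/eqP degEF cardT] _].
  have vEF w : vdeg F w = vdeg E w by rewrite -!degmE degEF.
  have [T'T|/subsetPn[v vT' vNT]] := boolP (T' \subset T).
    have TT' : T' = T by apply/eqP; rewrite eqEcard T'T cardT.
    case/negP: ng; apply: (lowI (F, T')) => //.
    by apply/mnm_lepP => w; rewrite !mnmE /= TT' vEF.
  exists v; last by apply: addT => //; apply: (subsetP hroots).
  by have := dle v; rewrite vT' (negPf vNT) vEF; clear; lia.
have szEF : size E = size F by rewrite !size_tuple.
have [E2 [sz2 lt2 H]] := lex_exchange szEF ltEF.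
have sz2' : size E2 == k by rewrite sz2 size_tuple.
have [e eE] : exists e : 'I_n -> nat, forall w, vdeg E w = e w by exists (vdeg E).
have [f fE] : exists f : 'I_n -> nat, forall w, vdeg F w = f w by exists (vdeg F).
have [e2 e2E] : exists e2 : 'I_n -> nat, forall w, vdeg E2 w = e2 w by exists (vdeg E2).
have gE w : genm (E, T) w = (k - e w + (w \in T))%N by rewrite mnmE /= eE.
have le_ek w : (e w <= k)%N by rewrite -eE.
have {}dle w : (k - f w + (w \in T') <= k - e w + (w \in T) + de w)%N by rewrite -fE -eE.
have low2 (al : 'X_{1..n}) : (forall w, (k - e2 w <= al w)%N) -> lower s (k, al).
  move=> le; apply: (lowI (Tuple sz2', set0)).
    apply: slt; first by rewrite sub0set.
    by rewrite /gen_le /= (lt_gtF lt2) (lt_eqF lt2).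
  by apply/mnm_lepP => w; rewrite mnmE inE addn0 /= e2E; apply: le.
case: H => [[u []]|[u [x []]]].
  rewrite fE eE => ltu d1.
  have {}d1 w : (e w <= e2 w + (w == u))%N by rewrite -eE -e2E; apply: d1.
  have [uT|uT] := boolP (u \in T).
    case/negP: ng; apply: low2 => w; rewrite gE.
    by have := d1 w; have := le_ek w; case: eqP => [->|_]; rewrite ?uT; nlia.
  exists u; first by move: (dle u) (le_ek u) ltu; rewrite (negPf uT); nlia.
  apply: low2 => w; rewrite mnmDE mnm1E gE.
  by have := d1 w; rewrite eq_sym; have := le_ek w; nlia.
rewrite !fE !eE => ru ltu ltx d2.
have {}d2 w : (e w <= e2 w + (w == u) + (w == x))%N by rewrite -eE -e2E; apply: d2.
have [uT|uT] := boolP (u \in T); last first.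
  exists u; last by apply: addT => //; apply: rootsP.
  by move: (dle u) (le_ek u) ltu; rewrite (negPf uT); nlia.
have [xu|xNu] := eqVneq x u.
  subst x; exists u; first by move: (dle u) (le_ek u) ltx; rewrite uT eqxx; nlia.
  apply: low2 => w; rewrite mnmDE mnm1E gE [u == w]eq_sym.
  by have := d2 w; have := le_ek w; case: (eqVneq w u) => [->|]; rewrite ?uT /=; nlia.
have [xT|xT] := boolP (x \in T).
  case/negP: ng; apply: low2 => w; rewrite gE.
  have := d2 w; have := le_ek w; case: (eqVneq w u) => [->|_].
    by rewrite uT eq_sym (negPf xNu); nlia.
  by case: (eqVneq w x) => [->|_]; rewrite ?xT; nlia.
exists x; first by move: (dle x) (le_ek x) ltx; rewrite (negPf xT); nlia.
apply: low2 => w; rewrite mnmDE mnm1E gE [x == w]eq_sym.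
have := d2 w; have := le_ek w; case: (eqVneq w u) => [->|_]; last by nlia.
by rewrite uT; nlia.
Qed.

Lemma colon_by_variables (s : seq gen) (g : gen) (de : 'X_{1..n}) :
  (forall h : gen, h \in s -> gen_le h g && (h.2 \subset roots)) ->
  (forall h : gen, h.2 \subset roots -> ~~ gen_le g h -> h \in s) ->
  g.2 \subset roots -> ~~ lower s (k, genm g) -> lower s (k, genm g + de)%MM ->
  exists2 v, de v != 0%N & lower s (k, genm g + U_(v))%MM.
Proof.
case: g => E T sle slt groots ng.
rewrite {1}/lower /rees_ge ltnn eqxx /= => /hasP[[F T'] hs hle].
have /andP[hg hroots] := sle _ hs.
exact: (colon_by_variables_aux slt groots hroots hs hg hle ng).
Qed.

End Generators.
End ReesMonomials.

(** * Membership in the Rees algebra *)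

Section ReesSupport.
Variables (K : fieldType) (n : nat) (G : sgraph n).
Local Notation m := #|edges G|.
Local Notation S := {mpoly K[n]}.
Local Notation A := {poly {mpoly K[n]}}.
Local Notation AX := (tpolynomials K n).
Local Notation I := (@comp_edge_ideal K n G).

Lemma ideal_pow_support k (f : S) al : ideal_pow I k f -> f@_al != 0 -> in_rees G (k, al).
Proof.
elim: k => [|k IH] /= in f al *.
  by move=> _ _; apply/in_reesP; exists [::].
case=> s [sI ->]; rewrite (raddf_sum (mcoeff al)) /= big_seq.
case/sum_neq0 => -[a b] /sI /= [[c ->] bI]; rewrite mulr_suml (raddf_sum (mcoeff al)) /=.
case/sum_neq0 => j _; rewrite comp_genE mulrAC => /mcoeffM_neq0[al1 [al2 [nz]]].
rewrite mcoeffX; case: (compm j =P al2) => [<- _ ->|_]; last by rewrite eqxx.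
case/mcoeffM_neq0: nz => [ga [de [_ bde ->]]].
have [Rx Ry] := T_stable_in_rees G; apply: Ry.
have := T_stable_mul 0 ga (T_stable_in_rees G) (IH _ _ bI bde).
by rewrite mdeg0 addn0 /umon big1 ?addm0 1?addmC // => i _; rewrite mnm0E mulm0n.
Qed.

Lemma ideal_pow_add k (f g : S) : ideal_pow I k f -> ideal_pow I k g -> ideal_pow I k (f + g).
Proof.
case: k => // k [s [sI ->]] [t [tI ->]]; exists (s ++ t); split; last by rewrite big_cat.
by move=> ab; rewrite mem_cat => /orP[/sI|/tI].
Qed.

Lemma ideal_pow_prod (E : seq 'I_m) (f : S) :
  ideal_pow I (size E) (f * \prod_(j <- E) comp_gen K j).
Proof.
elim: E f => //= j E IH f.
exists [:: (f * comp_gen K j, \prod_(i <- E) comp_gen K i)]; split; last first.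
  by rewrite big_seq1 big_cons mulrA.
move=> ab; rewrite inE => /eqP->; split=> /=; last by rewrite -[X in ideal_pow _ _ X]mul1r; apply: IH.
exists (fun i => if i == j then f else 0).
by rewrite (bigD1 j) //= eqxx big1 ?addr0 // => i /negPf->; rewrite mul0r.
Qed.

Lemma ideal_pow_monomial k al (c : K) : in_rees G (k, al) -> ideal_pow I k (c *: 'X_[al]).
Proof.
case/in_reesP => E [<- leE].
have prodE : \prod_(j <- E) comp_gen K j = 'X_[\sum_(j <- E) compm j]%MM.
  by rewrite -mprodXE; apply: eq_bigr => j _; rewrite comp_genE.
have dE v : ((\sum_(j <- E) compm j)%MM v + vdeg E v = size E)%N.
  elim: E {leE prodE} => [|j E IH]; first by rewrite big_nil mnm0E.
  by rewrite big_cons mnmDE vdeg_cons addnACA compmE IH.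
have le : (\sum_(j <- E) compm j <= al)%MM.
  by apply/mnm_lepP => v; have := leE v; rewrite -(dE v) leq_add2r.
rewrite -(submK le) mpolyXD scalerAl -prodE; exact: ideal_pow_prod.
Qed.

Lemma reesP (f : A) : rees I f <-> supported AX (in_rees G) f.
Proof.
split=> [fI [k al]|fR k]; first exact: ideal_pow_support.
rewrite [f`_k]mpolyE; elim/big_ind: _ => [||al _].
- by case: k => // k; exists [::]; rewrite big_nil.
- exact: ideal_pow_add.
have [->|nz] := eqVneq (f`_k)@_al 0; last exact: ideal_pow_monomial (fR (k, al) nz).
by rewrite scale0r; case: k => // k; exists [::]; rewrite big_nil.
Qed.

End ReesSupport.

(** * The upper bound *)

Section UpperBound.
Variables (K : fieldType) (n : nat) (G : sgraph n).
Hypothesis n_gt0 : (0 < n)%N.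
Local Notation m := #|edges G|.
Variable F : bigraded_free_resolution_of_K K n m.
Local Notation vanishing := (@vanishing_above K n G F (n%:Z - 1)).

Lemma generator_vanishing k l : (l < size (gens G k))%N ->
  vanishing (@lower n G k (take l.+1 (gens G k))) (@lower n G k (take l (gens G k))).
Proof.
set s := gens G k => lts.
have [g0 _] : exists g0, g0 \in s by case: (s) lts => // g1 s1 _; exists g1; rewrite mem_head.
pose g := nth g0 s l; have gs : g \in s by apply: mem_nth.
have groots : g.2 \subset roots G by rewrite -mem_gens.
have s_sorted i j : (i <= j)%N -> (j < size s)%N -> gen_le (nth g0 s i) (nth g0 s j).
  move=> ij js; apply: (sorted_leq_nth (@gen_le_trans n G k) (@gen_le_refl n G k)) => //.
    exact: (sort_sorted (@gen_le_total n G k)).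
  by rewrite inE (leq_ltn_trans ij).
have takeS : take l.+1 s = rcons (take l s) g by rewrite (take_nth g0).
(* A generator that is a multiple of an earlier one adds nothing. *)
have [low|nlow] := boolP (@lower n G k (take l s) (k, genm g)).
  apply: vanishing_above_refl => -[k' al] /orP[H|/andP[/= /eqP-> ]]; first by rewrite /lower H.
  rewrite takeS has_rcons => /orP[le|has_s]; last by rewrite /lower /= eqxx has_s orbT.
  move: low; rewrite /lower {1}/rees_ge /= ltnn eqxx /= => /hasP[h hs hle].
  by apply/orP; right; apply/hasP; exists h => //; apply: lepm_trans hle le.
apply: (@piece_vanishing _ _ _ _ _ _ _ k (genm g)).
- exact: T_stable_lower.
- exact: T_stable_lower.
- by rewrite takeS /lower /= eqxx has_rcons lepm_refl /= orbT.
- move=> k' al /orP[H|/andP[/= /eqP-> ]]; first by left; rewrite /lower H.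
  rewrite takeS has_rcons => /orP[le|has_s]; first by right.
  by left; rewrite /lower /= eqxx has_s orbT.
- move=> j; apply/orP; left; apply/andP; split=> //.
  exact: ((@T_stable_in_rees n G).2 _ _ _ (in_rees_genm g)).
- move=> de; apply: colon_by_variables => //.
    move=> h hs; have hs' := mem_take hs; rewrite -mem_gens hs' andbT.
    rewrite -(nth_index g0 hs') /g; apply: s_sorted => //.
    by apply: ltnW; rewrite -(in_take _ hs').
  move=> h hroots nle; have hs : h \in s by rewrite mem_gens.
  have hl : (index h s < l)%N.
    rewrite ltnNge; apply: contra nle => le.
    by rewrite -(nth_index g0 hs); apply: s_sorted => //; rewrite index_mem.
  by rewrite (in_take _ hs).
- rewrite mdeg_genm; apply: (@le_trans _ _ n.-1%:Z); last by lia.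
  by rewrite lez_nat; exact: (card_roots n_gt0 groots).
Qed.

Lemma degree_vanishing k : vanishing (@rees_ge n G k) (@rees_ge n G k.+1).
Proof.
have H l : (l <= size (gens G k))%N ->
    vanishing (@lower n G k (take l (gens G k))) (@rees_ge n G k.+1).
  elim: l => [_|l IH lts]; first by rewrite take0; apply: vanishing_above_refl => u; rewrite lower_nilE.
  apply: vanishing_above_trans (generator_vanishing lts) (IH (ltnW lts)).
  - exact: T_stable_rees_ge.
  - by move=> u H; rewrite /lower H.
  - move=> u /orP[H|/andP[uk /hasP[g gs le]]]; first by rewrite /lower H.
    rewrite /lower uk; apply/orP; right; apply/hasP; exists g => //.
    by move: gs; rewrite -(take_takel _ (leqnSn l)); apply: mem_take.
move=> i z a b lta hz zP cz; have := H _ (leqnn _); rewrite take_size => {}H.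
have [|w [hw wP zw]] := H i z a b lta hz _ cz.
  by move=> j; apply: supportedW (zP j) => u; rewrite lower_gens.
by exists w; split=> // j; apply: supportedW (wP j) => u; rewrite lower_gens.
Qed.

Lemma rees_vanishing k : vanishing (@in_rees n G) (@rees_ge n G k).
Proof.
elim: k => [|k IH]; first by apply: vanishing_above_refl => u Ru; rewrite /rees_ge Ru.
apply: (vanishing_above_trans _ _ _ IH (@degree_vanishing k)).
- exact: T_stable_rees_ge.
- by move=> u /andP[/ltnW ku Ru]; apply/andP.
- by move=> u /andP[].
Qed.

End UpperBound.

(** A cycle of bidegree (a, b) is a boundary up to an element of R in t-degrees
    at least k, for each k.  Once k exceeds the finitely many t-degrees that
    bidegree (a, b) allows, that element is zero. *)
Lemma Tor_upper_bound (K : fieldType) n (G : sgraph n) i (a b : int) : (0 < n)%N ->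
  Tor_neq0 (@rees_map K n G) (rees (@comp_edge_ideal K n G)) (@rees_homog K n) i a b ->
  a - i%:Z <= n%:Z - 1.
Proof.
move=> n_gt0 [F [z [zR hz cz nbz]]]; rewrite leNgt; apply/negP => lta; apply: nbz.
pose k := (\max_(j < rk F i) `|b - (bdeg j).2|%N).+1.
have [|j||w [hw wR zw]] := @rees_vanishing K n G n_gt0 F k i z a b _ hz.
- by move: lta; rewrite ltrBrDr addrC.
- by apply/(reesP G (z 0 j)).
- case: i @k z cz {zR hz lta} => [|i] k z cz //= j.
  by rewrite cz mxE; apply: supported0.
exists w; split=> [j|]; first exact/reesP.
apply/eqP; rewrite -subr_eq0; apply/eqP/rowP => j; rewrite [RHS]mxE.
apply: (@supported_disjoint _ _ _ (tpolynomials K n) (@rees_ge n G k)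
  (t_bideg (a - (bdeg j).1) (b - (bdeg j).2))) => //.
- move=> [l al] /andP[/= kl _] [/= _ lb].
  have : (`|b - (bdeg j).2| < k)%N by rewrite ltnS; apply: leq_bigmax.
  by rewrite -lb; lia.
apply/rees_homogP; apply: (hom_rowAD hz).
by move=> l; apply: (hom_rowAN (hom_rowA_diff hw)).
Qed.

(** * The Koszul resolution *)

Section Koszul.
Variables (K : fieldType) (n m : nat).
Local Notation T := (Tring K n m).
Local Notation var := ('I_n + 'I_m)%type.

Record free_complex := FreeComplex {
  crk : nat -> nat;
  cdeg : forall i, 'I_(crk i) -> int * int;
  cdiff : forall i, 'M[T]_(crk i.+1, crk i);
  ceps : 'cV[T]_(crk 0)
}.

Section Cone.
Variables (l : var) (C : free_complex).

Definition prk (i : nat) : nat := if i is i'.+1 then crk C i' else 0%N.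

Definition pdeg i : 'I_(prk i) -> int * int :=
  match i with 0 => fun=> (0, 0) | i'.+1 => @cdeg C i' end.

Definition pdiff i : 'M[T]_(crk C i, prk i) :=
  match i with 0 => 0 | i'.+1 => cdiff C i' end.

(** The mapping cone of multiplication by the variable l; prk, pdeg and pdiff are
    C shifted by one homological degree, and zero below. *)
Definition cone : free_complex := {|
  crk i := (crk C i + prk i)%N;
  cdeg i j := match split j with
              | inl j1 => cdeg j1
              | inr j2 => ((pdeg j2).1 + xdeg l, (pdeg j2).2 + ydeg l)
              end;
  cdiff i := block_mx (cdiff C i) 0 (tvar K l)%:M (- pdiff i);
  ceps := col_mx (ceps C) 0
|}.

End Cone.

Definition ground : free_complex := {|
  crk i := if i is 0 then 1%N else 0%N;
  cdeg i j := (0, 0);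
  cdiff i := 0;
  ceps := 1%:M
|}.

Definition koszul (L : seq var) : free_complex := foldr cone ground L.

(** C, augmented by ceps, is a bigraded free resolution of T / (B): ceps has
    its entries in T because a proper part B of the variables does not yet cut
    T down to K. *)
Record resolves (B : seq var) (C : free_complex) : Prop := Resolves {
  res_homog : forall i (j : 'I_(crk C i.+1)) (k : 'I_(crk C i)),
    T_homog (cdiff C i j k) ((cdeg j).1 - (cdeg k).1) ((cdeg j).2 - (cdeg k).2);
  res_deg0 : forall j : 'I_(crk C 0), ceps C j 0 != 0 -> cdeg j = (0, 0);
  res_surj : exists v : 'rV[T]_(crk C 0), (v *m ceps C) 0 0 = 1;
  res_exact0 : forall v : 'rV[T]_(crk C 0),
    vars_ideal B ((v *m ceps C) 0 0) <-> exists w, v = w *m cdiff C 0;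
  res_exactS : forall i (v : 'rV[T]_(crk C i.+1)),
    v *m cdiff C i = 0 <-> exists w, v = w *m cdiff C i.+1
}.

Lemma sub_mxE i j (A B : 'M[T]_(i, j)) x y : (A - B) x y = A x y - B x y.
Proof. by rewrite !mxE. Qed.

Lemma opp_mxE i j (A : 'M[T]_(i, j)) x y : (- A) x y = - A x y.
Proof. by rewrite mxE. Qed.

Lemma scale_mxE i j (c : T) (A : 'M[T]_(i, j)) x y : (c *: A) x y = c * A x y.
Proof. by rewrite mxE. Qed.

Lemma T_homog0 a b : T_homog (0 : T) a b.
Proof. by apply/T_homogP; apply: supported0. Qed.

Lemma T_homogN (p : T) a b : T_homog p a b -> T_homog (- p) a b.
Proof. by move=> /T_homogP hp; apply/T_homogP; apply: supportedN. Qed.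

Lemma ground_resolves : resolves [::] ground.
Proof.
split=> //=.
- by move=> i j k; rewrite mxE; apply: T_homog0.
- by exists 1%:M; rewrite mul1mx mxE.
- move=> v; rewrite mulmx1; split=> [v0|[w ->]]; last by rewrite mulmx0 mxE; apply: supported0.
  by exists 0; rewrite mulmx0; apply/rowP => j; rewrite mxE ord1; apply: vars_ideal_nil.
- by move=> i v; split=> _; [exists 0 | rewrite mulmx0]; apply/rowP => -[].
Qed.

Lemma cone_mul l C i (u : 'rV[T]_(crk C i.+1)) (e : 'rV[T]_(crk C i)) :
  row_mx u e *m cdiff (cone l C) i =
  row_mx (u *m cdiff C i + tvar K l *: e) (- (e *m pdiff C i)).
Proof. by rewrite /= mul_row_block mulmx0 add0r mul_mx_scalar mulmxN. Qed.

(** The long exact sequence of the cone: l is regular modulo B. *)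
Lemma cone_resolves B l C : l \notin B -> resolves B C -> resolves (l :: B) (cone l C).
Proof.
move=> lB [hC dC [v1 v1E] ex0 exS].
have dd i (w : 'rV_(crk C i.+2)) : w *m cdiff C i.+1 *m cdiff C i = 0.
  by apply/exS; exists w.
have dpd i (w : 'rV_(crk C i.+1)) : w *m cdiff C i *m pdiff C i = 0.
  by case: i w => [|i] w; rewrite /= ?mulmx0 ?dd.
split.
- move=> i j k; rewrite /= !mxE; case: (split j) => j1; rewrite !mxE.
    case: (split k) => k1; first exact: hC.
    by rewrite mxE; apply: T_homog0.
  case: (split k) => k1; rewrite !mxE.
    case: (eqVneq j1 k1) => [<-|_] /=; last by rewrite mulr0n; apply: T_homog0.
    rewrite mulr1n; have := @T_homog_tvar K n m l.
    by case: i j1 {k k1 j} => [|i] j1 /=; rewrite ![_ + xdeg l]addrC ![_ + ydeg l]addrC !addrK.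
  apply: T_homogN; case: i j1 k1 {j k} => [|i] j1 k1 /=; first by case: k1.
  have E (a b c : int) : a + c - (b + c) = a - b by lia.
  by rewrite !E; apply: hC.
- move=> j; rewrite /= mxE; case: (split j) => j1; first exact: dC.
  by rewrite mxE eqxx.
- by exists (row_mx v1 0); rewrite /= mul_row_col mulmx0 addr0.
- move=> v; rewrite -(hsubmxK v); move: (lsubmx v) (rsubmx v) => u e {v}.
  rewrite /= mul_row_col mulmx0 addr0; split.
    case/vars_ideal_cons => q [qB _].
    have /ex0[w1 w1E] : vars_ideal B (((u - tvar K l *: (q *: v1)) *m ceps C) 0 0).
      rewrite mulmxBl -!scalemxAl sub_mxE !scale_mxE [X in _ * (_ * X)]v1E mulr1.
      exact: qB.
    exists (row_mx w1 (q *: v1)); rewrite (cone_mul l w1) -w1E subrK.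
    by congr row_mx; apply/rowP => -[].
  case=> w; rewrite -(hsubmxK w); move: (lsubmx w) (rsubmx w) => w1 w2 {w}.
  rewrite (cone_mul l w1) => /eq_row_mx[-> _].
  rewrite mulmxDl mxE -scalemxAl scale_mxE; apply: supportedD.
    apply: (@vars_idealW _ _ _ B); first by move=> x xB; rewrite inE xB orbT.
    by apply/ex0; exists w1.
  by apply: vars_ideal_tvar; rewrite inE eqxx.
move=> i v; rewrite -(hsubmxK v); move: (lsubmx v) (rsubmx v) => u e {v}.
rewrite (cone_mul l u); split; last first.
  case=> w; rewrite -(hsubmxK w); move: (lsubmx w) (rsubmx w) => w1 w2 {w}.
  rewrite (cone_mul l w1) /= => /eq_row_mx[-> ->].
  rewrite mulmxDl dd add0r -scalemxAl scalerN subrr mulNmx dpd !oppr0.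
  by rewrite row_mx0.
rewrite -[0]row_mx0 => /eq_row_mx[ud /eqP]; rewrite oppr_eq0 => /eqP epd.
(* In positive degree e is a cycle; in degree 0 it is in the kernel of the
   augmentation because l times it is, and l is regular modulo B. *)
have [w2 eE] : exists w2, e = w2 *m cdiff C i.
  case: i u e ud epd => [|i] u e ud epd; last exact/exS.
  apply/ex0; apply: (vars_ideal_regular lB).
  have -> : tvar K l * (e *m ceps C) 0 0 = - ((u *m cdiff C 0) *m ceps C) 0 0.
    have -> : u *m cdiff C 0 = - (tvar K l *: e) by apply/eqP; rewrite -addr_eq0 ud.
    by rewrite mulNmx -scalemxAl opp_mxE scale_mxE opprK.
  by apply: supportedN; apply/ex0; exists u.
have /exS[w1 w1E] : (u + tvar K l *: w2) *m cdiff C i = 0.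
  by rewrite mulmxDl -scalemxAl -eE ud.
exists (row_mx w1 (- w2)); rewrite (cone_mul l w1) /= scalerN -w1E addrK.
by rewrite mulNmx opprK -eE.
Qed.

Lemma koszul_resolves L : uniq L -> resolves L (koszul L).
Proof.
elim: L => [_|l L IH /andP[lL uL]]; first exact: ground_resolves.
by apply: cone_resolves => //; apply: IH.
Qed.

Lemma T_residueM (p q : T) : T_residue (p * q) = T_residue p * T_residue q.
Proof. by rewrite /T_residue !rmorphM. Qed.

Lemma T_residue_mul i (v : 'rV[T]_i) (c : 'cV[T]_i) :
  (map_mx (@T_residue K n m) v *m map_mx (@T_residue K n m) c) 0 0 = T_residue ((v *m c) 0 0).
Proof.
rewrite !mxE /T_residue (raddf_sum (mcoeff 0%MM)) (raddf_sum (mcoeff 0%MM)) /=.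
by apply: eq_bigr => j _; rewrite !mxE; apply/esym/T_residueM.
Qed.

Lemma T_residue_eq0 (L : seq var) (p : T) : (forall l, l \in L) ->
  T_residue p = 0 <-> vars_ideal L p.
Proof.
move=> allL; split=> [p0 [mu nu] pu|pL].
  apply/hasP; have [/forallP mu0|] := boolP [forall j, mu j == 0%N]; last first.
    by rewrite negb_forall => /existsP[j muj]; exists (inr j).
  have [/forallP nu0|] := boolP [forall j, nu j == 0%N]; last first.
    by rewrite negb_forall => /existsP[j nuj]; exists (inl j).
  move: pu; have -> : mu = 0%MM by apply/mnmP => j; rewrite mnm0E; apply/eqP.
  have -> : nu = 0%MM by apply/mnmP => j; rewrite mnm0E; apply/eqP.
  by rewrite /= -/(T_residue p) p0 eqxx.
apply/eqP/negPn/negP => /(pL (0%MM, 0%MM)) /hasP[[l|l] _]; by rewrite /= mnm0E eqxx.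
Qed.

Section Resolution.
Variables (L : seq var) (uL : uniq L) (allL : forall l, l \in L).
Let C := koszul L.
Let resC : resolves L C := koszul_resolves uL.

Lemma koszul_deg0 (j : 'I_(crk C 0)) :
  map_mx (@T_residue K n m) (ceps C) j 0 != 0 -> cdeg j = (0, 0).
Proof.
rewrite mxE => nz; apply: (res_deg0 resC); apply: contraNneq nz => ->.
by rewrite /T_residue !mcoeff0.
Qed.

Lemma koszul_surj (c : K) : exists v : 'rV[T]_(crk C 0),
  (map_mx (@T_residue K n m) v *m map_mx (@T_residue K n m) (ceps C)) 0 0 = c.
Proof.
have [v v1] := res_surj resC; exists ((c%:MP)%:MP *: v).
by rewrite T_residue_mul -scalemxAl mxE v1 mulr1 /T_residue !mpolyCK.
Qed.

Lemma koszul_exact0 (v : 'rV[T]_(crk C 0)) :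
  (map_mx (@T_residue K n m) v *m map_mx (@T_residue K n m) (ceps C)) 0 0 = 0
  <-> exists w, v = w *m cdiff C 0.
Proof.
rewrite T_residue_mul; split=> [/(T_residue_eq0 _ allL)/(res_exact0 resC)//|H].
exact/(T_residue_eq0 _ allL)/(res_exact0 resC).
Qed.

Definition koszul_resolution : bigraded_free_resolution_of_K K n m :=
  @BigradedFreeResolution K n m (crk C) (@cdeg C) (cdiff C)
    (map_mx (@T_residue K n m) (ceps C)) (res_homog resC) koszul_deg0 koszul_surj
    koszul_exact0 (res_exactS resC).

End Resolution.
End Koszul.

(** * A Koszul cycle of the Rees algebra *)

Section KoszulClass.
Variables (K : fieldType) (n : nat) (G : sgraph n).
Local Notation m := #|edges G|.
Local Notation A := {poly {mpoly K[n]}}.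
Local Notation phi := (@rees_map K n G).
Local Notation var := ('I_n + 'I_m)%type.
Local Notation chain L i := 'rV[A]_(crk (koszul K L) i).

Variable label : var -> nat.

Definition avar (l : var) : A := phi (tvar K l).

Definition dA C i (w : 'rV[A]_(@crk K n m C i.+1)) : 'rV[A]_(crk C i) :=
  w *m map_mx phi (cdiff C i).

Lemma dA_cone l C i (u : 'rV[A]_(@crk K n m C i.+1)) (e : 'rV[A]_(crk C i)) :
  dA (C := cone l C) (row_mx u e) = row_mx (dA u + avar l *: e) (- (e *m map_mx phi (pdiff C i))).
Proof.
have phi0 : phi 0 = 0 by apply: raddf0.
rewrite /dA /= map_block_mx mul_row_block.
have -> : map_mx phi (0 : 'M_(crk C i.+1, prk C i)) = 0 by apply/matrixP => x y; rewrite !mxE.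
have -> : map_mx phi ((tvar K l)%:M : 'M_(crk C i)) = (avar l)%:M.
  by apply/matrixP => x y; rewrite !mxE; case: (x == y); rewrite ?mulr1n ?mulr0n.
have -> : map_mx phi (- pdiff C i) = - map_mx phi (pdiff C i).
  by apply/matrixP => x y; rewrite !mxE; apply: raddfN.
by rewrite mulmx0 add0r mul_mx_scalar mulmxN.
Qed.

(** The sum, over the basis vectors with exactly one variable of each label
    1, .., s, of the coefficient times these variables.  The recursion assumes
    that the variables are listed with decreasing labels: then no sign
    occurs. *)
Fixpoint Psi (L : seq var) (s : nat) : chain L s -> A :=
  match L return chain L s -> A with
  | [::] => match s return chain [::] s -> A with
            | 0 => fun w => w 0 0
            | _ => fun=> 0
            end
  | l :: L' => match s return chain (l :: L') s -> A with
      | 0 => fun w => Psi (lsubmx w)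
      | s'.+1 => fun w => Psi (lsubmx w) +
          (if label l == s'.+1 then avar l * Psi (L := L') (s := s') (rsubmx w) else 0)
      end
  end.

(** As [Psi], for the labels 0, .., s. *)
Fixpoint Xi (L : seq var) (s : nat) : chain L s.+1 -> A :=
  match L return chain L s.+1 -> A with
  | [::] => fun=> 0
  | l :: L' => fun w => Xi (lsubmx w) + (if label l == s then avar l *
      match s return chain L' s -> A with
      | 0 => @Psi L' 0
      | s'.+1 => @Xi L' s'
      end (rsubmx w) else 0)
  end.

Lemma PsiP L s (a : A) (w w' : chain L s) : Psi (a *: w + w') = a * Psi w + Psi w'.
Proof.
elim: L s w w' => [|l L IH] [|s] w w' /=.
- by rewrite !mxE.
- by rewrite mulr0 addr0.
- by rewrite linearP /= IH.
rewrite !linearP /= !IH; case: ifP => _; last by rewrite !addr0.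
by rewrite !mulrDr mulrCA addrACA.
Qed.

Lemma PsiD L s (w w' : chain L s) : Psi (w + w') = Psi w + Psi w'.
Proof. by have := PsiP 1 w w'; rewrite scale1r mul1r. Qed.

Lemma Psi0 L s : Psi (0 : chain L s) = 0.
Proof. by apply: (@addrI _ (Psi (0 : chain L s))); rewrite -PsiD !addr0. Qed.

Lemma PsiZ L s (a : A) (w : chain L s) : Psi (a *: w) = a * Psi w.
Proof. by have := PsiP a w 0; rewrite addr0 Psi0 addr0. Qed.

Lemma PsiN L s (w : chain L s) : Psi (- w) = - Psi w.
Proof. by rewrite -scaleN1r PsiZ mulN1r. Qed.

Lemma Xi0 L s : Xi (0 : chain L s.+1) = 0.
Proof.
elim: L s => [|l L IH] s //=; rewrite !linear0 IH add0r; case: ifP => // _.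
by case: s => [|s]; rewrite ?Psi0 ?IH mulr0.
Qed.

Lemma Psi_small L s (w : chain L s.+1) : all (fun l => label l <= s)%N L -> Psi w = 0.
Proof.
elim: L w => [|l L IH] w //= /andP[lels /IH->].
by rewrite add0r ltn_eqF.
Qed.

Local Notation descending := (pairwise (fun l l' : var => label l' <= label l)%N).

(** As a cochain on the simplex whose vertices are the variables, Psi is the
    wedge product of the forms w_1, .., w_s, where w_j is 1 on the variables
    with label j and 0 on the others.  Composition with the differential is
    multiplication by w_0 + .. + w_(s+1), in which w_1, .., w_s contribute
    nothing; the other two give Xi and Psi in degree s + 1. *)
Lemma Psi_d L s (w : chain L s.+1) : descending L -> all (fun l => label l <= s.+1)%N L ->
  Psi (dA w) = (-1) ^+ s * Xi w + Psi w.
Proof.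
elim: L s w => [|l L IH] s w.
  move=> _ _; rewrite mulr0 addr0; case: s w => [|s] w //=.
  by rewrite mxE big_ord0.
move=> /andP[ltl dL] /andP[lels Lles].
rewrite -[w]hsubmxK; move: (lsubmx w) (rsubmx w) => u e {w}.
rewrite (dA_cone l u e).
case: s u e lels Lles => [|s] u e lels Lles.
  have {}IH := IH 0%N u dL Lles.
  rewrite /= !row_mxKl !row_mxKr PsiD PsiZ IH expr0 !mul1r.
  by case: (label l) lels => [|[|]] //= _; rewrite ?addr0 ?addrA // addrAC.
have IHu := IH s.+1 u dL Lles.
rewrite /= !row_mxKl !row_mxKr PsiD PsiZ IHu PsiN.
case: (ltngtP (label l) s.+1) => [lt_s|gt_s|eq_s] /=.
- (* No variable of L has label s.+1. *)
  have -> : label l == s.+2 = false by rewrite ltn_eqF // ltnS ltnW.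
  rewrite (@Psi_small L s e) ?mulr0 ?addr0 //.
  by apply: sub_all ltl => l' /leq_ltn_trans/(_ lt_s).
- have -> : label l == s.+2 by rewrite eqn_leq lels gt_s.
  by rewrite !addr0 addrA.
rewrite eq_s ltn_eqF // addr0.
have -> : e *m map_mx phi (cdiff (koszul K L) s) = dA e by [].
rewrite (IH s e dL) //; last by apply: sub_all ltl => l'; rewrite eq_s.
rewrite exprS; set x := _ ^+ s; clearbody x; move: (Xi u) (Psi u) (Xi e) (Psi e) (avar l) => a b c d z.
ring.
Qed.

Definition edgem (j : 'I_m) : 'X_{1..n} := [multinom (v \in edge j : nat) | v < n].

Definition edgef (j : 'I_m) : A := 'X_[edgem j]%:P.

Definition onesm : 'X_{1..n} := [multinom 1%N | _ < n].

(** The common value x_1 .. x_n t of all f_j (u_j t). *)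
Definition Xt : A := 'X_[onesm]%:P * 'X.

Lemma avar_inl v : avar (inl v) = ('X_v : {mpoly K[n]})%:P.
Proof. exact: phiC. Qed.

Lemma avar_inr j : avar (inr j) = 'X_[compm j]%:P * 'X.
Proof. by rewrite /avar /= /rees_map mmapX mmap1U comp_genE. Qed.

Lemma edgef_avar j : edgef j * avar (inr j) = Xt.
Proof.
rewrite avar_inr /edgef mulrA -rmorphM /= -mpolyXD; congr (('X_[_])%:P * _).
by apply/mnmP => v; rewrite mnmDE !mnmE; case: (v \in edge j).
Qed.

Lemma Xt_neq0 : Xt != 0.
Proof.
apply: mulf_neq0; last by rewrite polyX_eq0.
by rewrite polyC_eq0 -msupp_eq0 msuppX.
Qed.

Section Cycle.
Variable rep : nat -> 'I_m.

Fixpoint one_chain (L : seq var) : chain L 0 :=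
  match L return chain L 0 with
  | [::] => 1%:M
  | l :: L' => row_mx (one_chain L') 0
  end.

(** The product of the basis vectors of y_(rep s), .., y_(rep 0), in the order of
    the list L. *)
Fixpoint Pi (L : seq var) (s : nat) : chain L s.+1 :=
  match L return chain L s.+1 with
  | [::] => 0
  | l :: L' => if l == inr (rep s)
      then row_mx 0 (match s return chain L' s with
                     | 0 => one_chain L'
                     | s'.+1 => Pi L' s'
                     end)
      else row_mx (Pi L' s) 0
  end.

Definition edgeprod (s : nat) : A := \prod_(j < s) edgef (rep j).

(** The boundary of [Pi] times f_0 .. f_s / (x_1 .. x_n t), see
    [edgeprod_dPi]; the recursion avoids the division. *)
Fixpoint Zeta (L : seq var) (s : nat) : chain L s :=
  match s return chain L s with
  | 0 => one_chain L
  | s'.+1 => match L return chain L s'.+1 with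
     | [::] => 0
     | l :: L' => if l == inr (rep s'.+1)
         then row_mx (edgeprod s'.+1 *: Pi L' s') (- (edgef (rep s'.+1) *: Zeta L' s'))
         else row_mx (Zeta L' s'.+1) 0
     end
  end.

Lemma Zeta0 L : Zeta L 0 = one_chain L.
Proof. by case: L. Qed.

Lemma Psi_one L : Psi (one_chain L) = 1.
Proof. by elim: L => [|l L IH] /=; rewrite ?mxE // row_mxKl. Qed.

Definition has_reps (L : seq var) s := forall j, (j <= s)%N ->
  (inr (rep j) : var) \in L /\ label (inr (rep j)) = j.

Lemma has_reps_cons l L s : descending (l :: L) -> has_reps (l :: L) s ->
  if l == inr (rep s) then forall s', s'.+1 = s -> has_reps L s' else has_reps L s.
Proof.
move=> /= /andP[ltl _] hL; have [sL slab] := hL s (leqnn s).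
case: eqP => [lE s' eqs j js'|/eqP lN j js].
  have js : (j < s)%N by rewrite -eqs.
  have [+ jlab] := hL j (ltnW js); rewrite inE lE => /orP[/eqP[/(congr1 (label \o inr))]|//].
  by rewrite /= slab jlab => js'E; rewrite js'E ltnn in js.
have [+ jlab] := hL j js; rewrite inE => /orP[/eqP jl|//].
move: sL; rewrite inE eq_sym (negPf lN) /= => /(allP ltl).
rewrite -jl slab jlab => sj; have eqjs : j = s by apply/eqP; rewrite eqn_leq js.
by move: lN; rewrite -jl eqjs eqxx.
Qed.

Lemma Xi_Pi L s : descending L -> has_reps L s -> Xi (Pi L s) = \prod_(j < s.+1) avar (inr (rep j)).
Proof.
elim: L s => [|l L IH] s dL hL; first by have [] := hL 0%N isT.
have := has_reps_cons dL hL; have /andP[ltl dL'] := dL.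
have [_ slab] := hL s (leqnn s).
rewrite /=; case: eqP => [-> hL'|_ hL'].
  rewrite row_mxKl Xi0 add0r slab eqxx row_mxKr big_ord_recr /= mulrC.
  case: s {hL slab} hL' => [|s] hL'; first by rewrite Psi_one big_ord0.
  by rewrite IH //; apply: hL'.
rewrite row_mxKl IH // row_mxKr; case: ifP => _; rewrite ?addr0 //.
by case: (s) => [|s']; rewrite ?Psi0 ?Xi0 mulr0 addr0.
Qed.

Lemma edgeprod_dPi L s : descending L -> has_reps L s ->
  edgeprod s.+1 *: dA (Pi L s) = Xt *: Zeta L s.
Proof.
elim: L s => [|l L IH] s dL hL; first by have [] := hL 0%N isT.
have := has_reps_cons dL hL; have /andP[ltl dL'] := dL.
have eS : edgeprod s.+1 = edgeprod s * edgef (rep s) by rewrite /edgeprod big_ord_recr.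
have d0 i : dA (0 : chain L i.+1) = 0 by rewrite /dA mul0mx.
case: eqP => [lE hL'|/eqP/negPf lN hL'].
  case: s lE hL hL' eS => [|s] lE hL hL' eS.
    rewrite /= lE eqxx (dA_cone _ (0 : chain L 1)) d0 add0r eS /edgeprod big_ord0 mul1r.
    rewrite scale_row_mx scalerA edgef_avar scale_row_mx.
    by congr row_mx; apply/rowP => -[].
  rewrite /= lE eqxx (dA_cone _ (0 : chain L s.+2)) d0 add0r eS.
  rewrite scale_row_mx scalerA -mulrA edgef_avar scale_row_mx scalerA mulrC; congr row_mx.
  rewrite scalerN scalerN scalerA [Xt * _]mulrC -[in RHS]scalerA -IH //; last exact: hL'.
  by rewrite scalerA mulrC.
have -> : Pi (l :: L) s = row_mx (Pi L s) 0 by rewrite /= lN.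
have -> : Zeta (l :: L) s = row_mx (Zeta L s) 0 by case: (s) lN => [|s'] lN /=; rewrite ?Zeta0 ?lN.
rewrite (dA_cone _ (Pi L s)) scaler0 addr0 mul0mx oppr0 !scale_row_mx !scaler0.
by rewrite IH.
Qed.

Lemma Psi_Zeta L s : descending L -> has_reps L s -> all (fun l => label l <= s)%N L ->
  Psi (Zeta L s) = (-1) ^+ s * Xt ^+ s.
Proof.
move=> dL hL Ls; apply: (mulfI Xt_neq0); rewrite -PsiZ -edgeprod_dPi // PsiZ.
rewrite Psi_d //; last by apply: sub_all Ls => l /leqW.
rewrite (Psi_small (Pi L s)) // addr0 Xi_Pi // mulrCA /edgeprod -big_split /=.
under eq_bigr do rewrite edgef_avar.
by rewrite prodr_const card_ord exprS mulrCA.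
Qed.

End Cycle.
End KoszulClass.

(** * The cycle is not a boundary *)

Section NotBoundary.
Variables (K : fieldType) (n : nat) (G : sgraph n).
Local Notation m := #|edges G|.
Local Notation A := {poly {mpoly K[n]}}.
Local Notation AX := (tpolynomials K n).
Local Notation tmono := (nat * 'X_{1..n})%type.
Local Notation var := ('I_n + 'I_m)%type.
Local Notation chain L i := 'rV[A]_(crk (koszul K L) i).
Variable label : var -> nat.
Hypothesis label_edge : forall (j : 'I_m) v, v \in edge j -> label (inl v) = label (inr j).

(** A necessary condition for x^al t^k to be a product of a monomial of R with
    one variable of each label i < c.  A variable y_j leaves a trace as an edge in
    E, and a variable x_v as an exponent at v larger than E forces. *)
Definition hits (c : nat) (u : tmono) : Prop :=
  exists E : seq 'I_m, [/\ size E = u.1, forall v, (u.1 <= u.2 v + vdeg E v)%N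
    & forall i, (i < c)%N -> (exists2 j, j \in E & label (inr j) = i) \/
        (exists2 v, label (inl v) = i & (u.1 < u.2 v + vdeg E v)%N)].

Lemma hits_mul l c f : label l = c -> supported AX (hits c) f ->
  supported AX (hits c.+1) (avar K l * f).
Proof.
case: l => [x|j] lc hf.
  rewrite avar_inl => -[k al]; rewrite /= coefCM => /mcoeffM_neq0[al1 [al2 [nz /(hf (k, al2)) hf2 ->]]].
  move: nz; rewrite mcoeffX; case: (U_(x)%MM =P al1) => [<- _|]; last by rewrite eqxx.
  case: hf2 => E [szE leE hE]; exists E; split=> //= [v|i].
    by apply: leq_trans (leE v) _; rewrite mnmDE leq_add2r leq_addl.
  rewrite ltnS leq_eqVlt => /orP[/eqP->|/hE[?|[v lv ltv]]].
  - by right; exists x; rewrite // mnmDE mnm1E eqxx -addnA add1n ltnS; apply: leE.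
  - by left.
  by right; exists v => //; apply: leq_trans ltv _; rewrite mnmDE leq_add2r leq_addl.
rewrite avar_inr -mulrA => -[k al] /=; rewrite coefCM coefXM.
case: k => [|k]; first by rewrite mulr0 mcoeff0 eqxx.
move=> /mcoeffM_neq0[al1 [al2 [nz /(hf (k, al2)) hf2 ->]]].
move: nz; rewrite mcoeffX; case: (compm j =P al1) => [<- _|]; last by rewrite eqxx.
case: hf2 => E /= [szE leE hE]; exists (j :: E); split=> [|v|i]; first by rewrite /= szE.
  have := leE v; have := compmE j v; rewrite vdeg_cons mnmDE /=; nlia.
rewrite ltnS leq_eqVlt => /orP[/eqP->|/hE[[j' j'E lj']|[v lv ltv]]].
- by left; exists j; rewrite ?mem_head.
- by left; exists j' => //; rewrite inE j'E orbT.
right; exists v => //; move: ltv; have := compmE j v; rewrite vdeg_cons mnmDE /=; nlia.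
Qed.

Lemma Psi0_supported L (w : chain L 0) P : (forall j, supported AX P (w 0 j)) ->
  supported AX P (Psi label w).
Proof.
elim: L w => [|l L IH] w wP; first exact: wP.
by apply: IH => j; rewrite mxE; apply: wP.
Qed.

Lemma Xi_supported L s (w : chain L s.+1) : (forall j, supported AX (hits 0) (w 0 j)) ->
  supported AX (hits s.+1) (Xi label w).
Proof.
elim: L s w => [|l L IH] s w wP; first exact: supported0.
rewrite /=; apply: supportedD; first by apply: IH => j; rewrite mxE; apply: wP.
case: eqP => [ls|_]; last exact: supported0.
apply: hits_mul => //; case: s {ls} w wP => [|s] w wP.
  by apply: Psi0_supported => j; rewrite mxE; apply: wP.
by apply: IH => j; rewrite mxE; apply: wP.
Qed.

(** In (x_1 .. x_n t)^s a vertex v with a surplus is covered by an edge of E, so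
    each of the s + 1 labels is the label of one of the s edges of E. *)
Lemma not_hits s : ~ hits s.+1 (s, [multinom s | _ < n]).
Proof.
case=> E [/= szE _ hE].
have : {subset iota 0 s.+1 <= map (fun j => label (inr j)) E}.
  move=> i; rewrite mem_iota add0n => /andP[_ /hE[[j jE <-]|[v lv]]].
    by apply/mapP; exists j.
  rewrite mnmE -[X in (X < _)%N]addn0 ltn_add2l -has_count => /hasP[j jE vj].
  by apply/mapP; exists j => //; rewrite -lv; apply: label_edge.
by move/(uniq_leq_size (iota_uniq 0 s.+1)); rewrite size_iota size_map szE ltnn.
Qed.

Lemma onesm_exp s : (Xt K n ^+ s)`_s@_[multinom s | _ < n] = 1.
Proof.
rewrite /Xt exprMn -rmorphXn /= mpolyXn coefCM coefXn eqxx mulr1 mcoeffX.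
suff -> : (onesm n *+ s)%MM = [multinom s | _ < n] by rewrite eqxx.
by apply/mnmP => v; rewrite mulmnE !mnmE mul1n.
Qed.

Lemma Psi_not_boundary L s (z : chain L s) (w : chain L s.+1) :
  pairwise (fun l l' : var => label l' <= label l)%N L ->
  all (fun l => label l <= s)%N L ->
  Psi label z = (-1) ^+ s * Xt K n ^+ s ->
  (forall j, rees (@comp_edge_ideal K n G) (w 0 j)) -> z <> dA w.
Proof.
move=> dL Ls Psiz wR zE; move: Psiz.
rewrite zE Psi_d //; last by apply: sub_all Ls => l /leqW.
rewrite Psi_small // addr0 => /(mulfI (_ : (-1) ^+ s != 0)) => XiE.
have : supported AX (hits s.+1) (Xi label w).
  apply: Xi_supported => j; have /reesP := wR j; apply: supportedW => -[k al] /in_reesP[E [szE leE]].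
  by exists E.
rewrite XiE ?signr_eq0 // => /(_ (s, [multinom s | _ < n])) /=; rewrite onesm_exp oner_eq0.
by move/(_ isT)/not_hits.
Qed.

Definition hom_chain C i (w : 'rV[A]_(@crk K n m C i)) (a b : int) : Prop :=
  forall j, rees_homog (w 0 j) (a - (cdeg j).1) (b - (cdeg j).2).

Lemma rees_homog0 a b : rees_homog (0 : A) a b.
Proof. by apply/rees_homogP; apply: supported0. Qed.

Lemma hom_chain0 C i a b : hom_chain (0 : 'rV[A]_(@crk K n m C i)) a b.
Proof. by move=> j; rewrite mxE; apply: rees_homog0. Qed.

Lemma hom_chainZ C i (w : 'rV[A]_(@crk K n m C i)) f a b c d :
  rees_homog f a b -> hom_chain w c d -> hom_chain (f *: w) (a + c) (b + d).
Proof. by move=> hf hw j; rewrite mxE -!addrA; apply: rees_homogM. Qed.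

Lemma hom_chain_row C l i (u : 'rV[A]_(@crk K n m C i.+1)) (e : 'rV[A]_(crk C i)) a b :
  hom_chain u a b -> hom_chain e (a - xdeg l) (b - ydeg l) ->
  hom_chain (C := cone l C) (i := i.+1) (row_mx u e) a b.
Proof.
move=> hu he j; rewrite /= mxE; case: (split j) => j1; first exact: hu.
have E (x y z : int) : x - (y + z) = x - z - y by lia.
by rewrite /= !E; apply: he.
Qed.

Lemma hom_chain_row0 C l i (u : 'rV[A]_(@crk K n m C i)) a b :
  hom_chain u a b -> hom_chain (C := cone l C) (i := i) (row_mx u 0) a b.
Proof.
by move=> hu j; rewrite /= mxE; case: (split j) => j1; [apply: hu | rewrite mxE; apply: rees_homog0].
Qed.

Variable rep : nat -> 'I_m.

Lemma rees_homog1 : rees_homog (1 : A) 0 0.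
Proof.
apply/rees_homogP => -[k al] /=; rewrite coef1; case: k => [|k]; last by rewrite mcoeff0 eqxx.
rewrite mcoeff1; case: (al =P 0%MM) => [-> _|]; last by rewrite eqxx.
by rewrite /t_bideg /= mdeg0 mul0r.
Qed.

Lemma mdeg_edgem (j : 'I_m) : mdeg (edgem j) = 2%N.
Proof.
rewrite mdegE -(card_edge j) -sum1_card [RHS]big_mkcond; apply: eq_bigr => v _.
by rewrite mnmE; case: ifP.
Qed.

Lemma rees_homog_edgef (j : 'I_m) : rees_homog (edgef K j) 2 0.
Proof.
apply/rees_homogP => -[k al] /=; rewrite coefC; case: k => [|k]; last by rewrite mcoeff0 eqxx.
rewrite mcoeffX; case: (edgem j =P al) => [<- _|]; last by rewrite eqxx.
by rewrite /t_bideg /= mul0r addr0 mdeg_edgem.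
Qed.

Lemma rees_homog_edgeprod s : rees_homog (edgeprod K rep s) (2 * s%:Z) 0.
Proof.
elim: s => [|s IH]; first by rewrite /edgeprod big_ord0 mulr0; apply: rees_homog1.
rewrite /edgeprod big_ord_recr /=; have := rees_homogM IH (@rees_homog_edgef (rep s)).
by rewrite addr0 (_ : 2 * s%:Z + 2 = 2 * s.+1%:Z) //; lia.
Qed.

Lemma one_chain_hom L : hom_chain (one_chain K L) 0 0.
Proof.
elim: L => [|l L IH]; last exact: hom_chain_row0.
by move=> j; rewrite /= ord1 mxE eqxx subr0; apply: rees_homog1.
Qed.

Lemma Pi_hom L s : hom_chain (Pi K rep L s) 0 s.+1.
Proof.
elim: L s => [|l L IH] s; first by move=> j; rewrite mxE; apply: rees_homog0.
rewrite /=; case: eqP => [->|_]; last exact: hom_chain_row0.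
apply: hom_chain_row; first exact: hom_chain0.
case: s => [|s] /=; rewrite subr0.
  by rewrite subrr; apply: one_chain_hom.
by rewrite (_ : s.+2%:Z - 1 = s.+1) //; lia.
Qed.

Lemma Zeta_hom L s : hom_chain (Zeta K rep L s) (2 * s%:Z) s.
Proof.
elim: L s => [|l L IH] [|s]; rewrite ?Zeta0.
- exact: one_chain_hom.
- by move=> j; rewrite mxE; apply: rees_homog0.
- exact: one_chain_hom.
rewrite /=; case: eqP => [->|_]; last exact: hom_chain_row0.
apply: hom_chain_row.
  have := hom_chainZ (@rees_homog_edgeprod s.+1) (@Pi_hom L s).
  by rewrite addr0 add0r.
rewrite /= subr0; have := hom_chainZ (@rees_homog_edgef (rep s.+1)) (IH s).
rewrite add0r (_ : 2 + 2 * s%:Z = 2 * s.+1%:Z); last by lia.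
rewrite (_ : s%:Z = s.+1%:Z - 1); last by lia.
by move=> h j; rewrite mxE; apply: rees_homogN.
Qed.

Definition const_t (u : tmono) : Prop := u.1 = 0%N.

Lemma const_t_C (c : {mpoly K[n]}) : supported AX const_t c%:P.
Proof. by move=> [[|k] al] //=; rewrite coefC /= mcoeff0 eqxx. Qed.

Lemma const_tM f g : supported AX const_t f -> supported AX const_t g ->
  supported AX const_t (f * g).
Proof. by move=> hf hg; apply: (supportedM hf hg) => u v; rewrite /const_t /= => -> ->. Qed.

Definition chain_const (L : seq var) i (w : chain L i) := forall j, supported AX const_t (w 0 j).

Lemma edgeprod_const s : supported AX const_t (edgeprod K rep s).
Proof. by rewrite /edgeprod -rmorph_prod; apply: const_t_C. Qed.

Lemma one_chain_const L : chain_const (one_chain K L).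
Proof.
elim: L => [|l L IH] j; rewrite mxE; first by rewrite ord1 eqxx; apply: (@const_t_C 1).
by case: (split j) => j1; [apply: IH | rewrite mxE; apply: supported0].
Qed.

Lemma Pi_const L s : chain_const (Pi K rep L s).
Proof.
elim: L s => [|l L IH] s; first by move=> j; rewrite mxE; apply: supported0.
rewrite /=; case: eqP => _ j; rewrite /= mxE; case: (split j) => j1; rewrite ?mxE;
  try exact: supported0; last exact: IH.
by case: s j1 {j} => [|s] j1; [apply: one_chain_const | apply: IH].
Qed.

Lemma Zeta_const L s : chain_const (Zeta K rep L s).
Proof.
elim: L s => [|l L IH] [|s]; rewrite ?Zeta0; try exact: one_chain_const.
  by move=> j; rewrite mxE; apply: supported0.
rewrite /=; case: eqP => _ j; rewrite /= mxE; case: (split j) => j1.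
- by rewrite mxE; apply: const_tM; [apply: edgeprod_const | apply: Pi_const].
- by rewrite !mxE; apply: supportedN; apply: const_tM; [apply: const_t_C | apply: IH].
- exact: IH.
- by rewrite mxE; apply: supported0.
Qed.

Lemma const_t_rees f : supported AX const_t f -> rees (@comp_edge_ideal K n G) f.
Proof.
move=> hf; apply/reesP => -[k al] /hf; rewrite /const_t /= => ->.
by apply/in_reesP; exists [::].
Qed.

End NotBoundary.

(** * One label for each component *)

Section LowerBound.
Variables (K : fieldType) (n : nat) (G : sgraph n).
Local Notation m := #|edges G|.
Local Notation A := {poly {mpoly K[n]}}.
Local Notation var := ('I_n + 'I_m)%type.

(** The class is that of [Zeta], which for s = 0 is the class of 1 in Tor_0 and
    makes sense whether or not there is an edge. *)
Lemma Tor_nonzero (label : var -> nat) s :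
  (forall (j : 'I_m) v, v \in edge j -> label (inl v) = label (inr j)) ->
  (forall l, (label l <= s)%N) ->
  (s = 0%N \/ exists rep : nat -> 'I_m, forall j, (j <= s)%N -> label (inr (rep j)) = j) ->
  Tor_neq0 (@rees_map K n G) (rees (@comp_edge_ideal K n G)) (@rees_homog K n) s (2 * s%:Z) s.
Proof.
move=> label_edge les reps.
(* [Psi] carries no signs because the labels decrease along the list. *)
pose ge_label := fun l l' : var => (label l' <= label l)%N.
pose L : seq var := sort ge_label (enum {: var}).
have uL : uniq L by rewrite sort_uniq enum_uniq.
have allL l : l \in L by rewrite mem_sort mem_enum.
have dL : pairwise ge_label L.
  rewrite -sorted_pairwise; last by move=> x y z h1 h2; apply: leq_trans h2 h1.
  by apply: sort_sorted => x y; apply: leq_total.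
have Ls : all (fun l => label l <= s)%N L by apply/allP.
pose F := koszul_resolution K uL allL.
suff [z [hz zR Psiz cz]] : exists z : 'rV[A]_(crk (koszul K L) s),
    [/\ hom_chain z (2 * s%:Z) s, forall j, rees (@comp_edge_ideal K n G) (z 0 j),
        Psi label z = (-1) ^+ s * Xt K n ^+ s & tensor_cycle (@rees_map K n G) (F := F) z].
  exists F, z; split=> // -[w [wR zE]].
  exact: (Psi_not_boundary label_edge dL Ls Psiz wR zE).
case: s les reps Ls => [|s] les reps Ls.
  exists (one_chain K L); split=> // [|j|].
  - exact: one_chain_hom.
  - by apply: const_t_rees; apply: one_chain_const.
  - by rewrite Psi_one mul1r.
case: reps => // -[rep lrep].
have hL : has_reps label rep L s.+1 by move=> j /lrep.
exists (Zeta K rep L s.+1); split=> [|j||].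
- exact: Zeta_hom.
- by apply: const_t_rees; apply: Zeta_const.
- exact: Psi_Zeta.
have dd : dA (dA (Pi K rep L s.+1)) = 0 by apply: (@diff_diffA K n G F).
have Xd : Xt K n *: dA (Zeta K rep L s.+1) = 0.
  rewrite /dA scalemxAl -(edgeprod_dPi K dL hL) -scalemxAl.
  by rewrite -/(dA (dA (Pi K rep L s.+1))) dd scaler0.
apply/rowP => j; have /rowP/(_ j) := Xd; rewrite !mxE => /eqP.
by rewrite mulf_eq0 (negPf (Xt_neq0 K n)) => /eqP.
Qed.

Local Notation bigcomps := [set C in components G | (2 <= #|C|)%N].

Lemma connect_equiv : {in [set: 'I_n] & &, equivalence_rel (connect (adj G))}.
Proof.
move=> x y z _ _ _; split; first exact: connect0.
move=> xy; apply/idP/idP; last exact: connect_trans.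
by apply: connect_trans; rewrite (sym_connect_sym (adj_sym G)).
Qed.

Lemma components_partition : partition (components G) [set: 'I_n].
Proof. exact: (equivalence_partitionP connect_equiv). Qed.

Lemma pblock_components x y : (y \in pblock (components G) x) = connect (adj G) x y.
Proof. by rewrite (pblock_equivalence_partition connect_equiv) ?inE. Qed.

Lemma pblock_adj x y : adj G x y -> pblock (components G) x = pblock (components G) y.
Proof.
move=> xy; have /and3P[/eqP cov triv _] := components_partition.
apply/eqP; rewrite eq_pblock ?cov ?inE //.
by rewrite pblock_components connect1.
Qed.

(** Isolated vertices get the label 0, which is harmless: only the labels of
    vertices on edges are constrained. *)
Definition vlabel (v : 'I_n) : nat :=
  if pblock (components G) v \in bigcomps then index (pblock (components G) v) (enum bigcomps)
  else 0%N.

Definition clabel (l : var) : nat :=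
  match l with
  | inl v => vlabel v
  | inr j => if [pick v in edge j] is Some v then vlabel v else 0%N
  end.

Lemma clabel_edge (j : 'I_m) v : v \in edge j -> clabel (inl v) = clabel (inr j).
Proof.
move=> vj /=; case: pickP => [w wj|/(_ v)]; last by rewrite vj.
have [p [q [pq _ jE]]] := edgeP j.
have pE u : u \in edge j -> pblock (components G) u = pblock (components G) p.
  by rewrite jE !inE => /orP[/eqP->//|/eqP->]; rewrite (pblock_adj pq).
by rewrite /vlabel (pE v vj) (pE w wj).
Qed.

Lemma clabel_le l : (clabel l <= (nontrivial_components G).-1)%N.
Proof.
have vle v : (vlabel v <= (nontrivial_components G).-1)%N.
  rewrite /vlabel; case: ifP => // vD.
  suff : (index (pblock (components G) v) (enum bigcomps) < nontrivial_components G)%N by lia.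
  by rewrite /nontrivial_components cardE index_mem mem_enum.
by case: l => [v|j] //=; case: pickP.
Qed.

Lemma component_edge j : (j < nontrivial_components G)%N ->
  exists e : 'I_m, clabel (inr e) = j.
Proof.
rewrite /nontrivial_components cardE => ltj.
pose C := nth set0 (enum bigcomps) j.
have CD : C \in bigcomps by rewrite -mem_enum mem_nth.
have := CD; rewrite inE => /andP[Ccomp /card_gt1P[x [y [xC yC xNy]]]].
have /and3P[_ triv _] := components_partition.
have Cx : pblock (components G) x = C by apply: def_pblock.
have : connect (adj G) x y by rewrite -pblock_components Cx.
case/connectP => -[|x' p] /=; first by move=> _ yx; rewrite yx eqxx in xNy.
move=> /andP[xx' _] _; have [e eE] := adj_edge xx'.
have xe : x \in edge e by have := eE x; rewrite eqxx; case: (x \in edge e).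
exists e; apply: etrans (esym (clabel_edge xe)) _.
by rewrite /= /vlabel Cx CD index_uniq ?enum_uniq.
Qed.

Lemma Tor_components : let s := (nontrivial_components G).-1 in
  Tor_neq0 (@rees_map K n G) (rees (@comp_edge_ideal K n G)) (@rees_homog K n) s (2 * s%:Z) s.
Proof.
apply: (Tor_nonzero clabel_edge clabel_le).
have [->|c_gt0] := posnP (nontrivial_components G); first by left.
right; have /fin_all_exists[f fE] (j : 'I_(nontrivial_components G).-1.+1) :
    exists e : 'I_m, clabel (inr e) = j.
  by apply: component_edge; rewrite -[X in (_ < X)%N](prednK c_gt0).
by exists (fun j => f (inord j)) => j js; rewrite fE inordK.
Qed.

End LowerBound.

(** * The bounds *)

Lemma int_set_max (Q : int -> Prop) (hi x : int) : Q x -> (forall y, Q y -> y <= hi) ->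
  exists r, [/\ Q r, x <= r & forall y, Q y -> y <= r].
Proof.
move=> + Qhi; have [d] := ubnP `|hi - x|%N; elim: d x => // d IH x; rewrite ltnS => led Qx.
have [[y [Qy ltxy]]|maxx] := classic (exists y, Q y /\ x < y).
  have [|r [Qr yr maxr]] := IH y _ Qy; first by have := Qhi y Qy; lia.
  by exists r; split=> //; apply: le_trans (ltW ltxy) yr.
exists x; split=> // y Qy; rewrite leNgt; apply/negP => ltxy.
by apply: maxx; exists y.
Qed.

Theorem theorem1p2 (K : fieldType) (n : nat) (n_gt0 : (0 < n)%N)
    (G : sgraph n) :
  exists r : int,
    is_reg_x_rees K G r
    /\ (nontrivial_components G)%:Z - 1 <= r
    /\ r <= n%:Z - 1.
Proof.
pose Q (r : int) := exists (i b : nat) (a : int),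
  Tor_neq0 (@rees_map K n G) (rees (@comp_edge_ideal K n G)) (@rees_homog K n) i a b%:Z
  /\ r = a - i%:Z.
pose s := (nontrivial_components G).-1.
have Qs : Q s%:Z by exists s, s, (2 * s%:Z); split; [exact: Tor_components | lia].
have Qle r : Q r -> r <= n%:Z - 1.
  by case=> i [b [a [Tn ->]]]; apply: Tor_upper_bound n_gt0 Tn.
have [r [Qr sr maxr]] := int_set_max Qs Qle.
exists r; split; last by split; [apply: le_trans sr; rewrite /s; lia | apply: Qle].
split=> // i b a Tn; apply: maxr; by exists i, b, a.
Qed.
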